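(* Let $M>0$ and $\alpha\in(0,1]$, let $f=h+\overline{g}\in\mathcal{P}_{\mathcal{H}}^0(\alpha,M)$ with $h(z)=z+\sum_{n=2}^\infty a_nz^n$ and $g(z)=\sum_{n=2}^\infty b_nz^n$ for $z\in\mathbb{D}$, and let $\phi\in\mathcal{A}$ be such that $\mathrm{Re}\left(\phi(z)/z\right)>1/2$ for $z\in\mathbb{D}$. Then $f\tilde{*}\phi\in\mathcal{P}_{\mathcal{H}}^0(\alpha,M)$.
   Context: $\mathbb{D}=\{z\in\mathbb{C}:|z|<1\}$. $\mathcal{A}$ is the class of analytic functions $\phi$ in $\mathbb{D}$ with $\phi(0)=\phi'(0)-1=0$; at $z=0$, $\phi(z)/z$ is understood as its limit $1$. $\mathcal{H}$ is the class of complex-valued harmonic functions $f=h+\overline{g}$ in $\mathbb{D}$, with $h,g$ analytic in $\mathbb{D}$ and $h(0)=h'(0)-1=0$, $g(0)=0$. For $M>0$ and $\alpha\in(0,1]$, $\mathcal{P}_{\mathcal{H}}^0(\alpha,M)$ is the class of all $f=h+\overline{g}\in\mathcal{H}$ with $g'(0)=0$ and $$\mathrm{Re}\left((1-\alpha)h'(z)+\alpha zh''(z)\right)>-M+\left|(1-\alpha)g'(z)+\alpha zg''(z)\right|\quad\text{for all } z\in\mathbb{D}.$$ The convolution (Hadamard product) of analytic functions $\psi_1(z)=\sum_{n\ge0}a_nz^n$ and $\psi_2(z)=\sum_{n\ge0}b_nz^n$ in $\mathbb{D}$ is $(\psi_1*\psi_2)(z)=\sum_{n\ge0}a_nb_nz^n$.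 For $f=h+\overline{g}$ harmonic and $\phi$ analytic in $\mathbb{D}$, $f\tilde{*}\phi=h*\phi+\overline{g*\phi}$. *)

(* Defs.v *)
From Stdlib Require Import Reals Factorial.
From Coquelicot Require Import Coquelicot.

Open Scope R_scope.

Definition unit_disc (z : C) : Prop := Cmod z < 1.

(* Functions on the disc are total maps [C -> C]; their values outside the open
   disc are irrelevant to every notion below. *)

Definition analytic_at (f : C -> C) (z0 : C) : Prop :=
  exists (c : nat -> C) (r : R), 0 < r /\
    forall z : C, Cmod (z - z0)%C < r ->
      @is_pseries C_AbsRing C_NormedModule c (z - z0)%C (f z).

Definition analytic_in_disc (f : C -> C) : Prop :=
  forall z : C, unit_disc z -> analytic_at f z.

(* [C_derive] is a limit along real increments only; it is the complex derivative
   wherever that exists ([C_derive_correct]), hence for analytic functions. *)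
Definition C_derive_n (f : C -> C) (n : nat) : C -> C := Nat.iter n C_derive f.

(* The coefficient of z^n in the expansion of [f] at the origin. *)
Definition taylor_coeff (f : C -> C) (n : nat) : C :=
  (C_derive_n f n (RtoC 0) / RtoC (INR (fact n)))%C.

Definition CSeries (u : nat -> C) : C :=
  (Series (fun n => Re (u n)), Series (fun n => Im (u n))).

Definition hadamard (psi1 psi2 : C -> C) (z : C) : C :=
  CSeries (fun n => (taylor_coeff psi1 n * taylor_coeff psi2 n * z ^ n)%C).

Definition class_A (phi : C -> C) : Prop :=
  analytic_in_disc phi /\ phi (RtoC 0) = RtoC 0 /\ C_derive phi (RtoC 0) = RtoC 1.

(* [phi z / z] with the removable singularity of a member of class A filled in:
   Coquelicot's [phi 0 / 0] would be 0. *)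
Definition div_by_id (phi : C -> C) (z : C) : C :=
  if Ceq_dec z (RtoC 0) then RtoC 1 else (phi z / z)%C.

(* [f] belongs to the class H, with f = h + conj g the representation required
   there. *)
Definition class_H_repr (f h g : C -> C) : Prop :=
  analytic_in_disc h /\ analytic_in_disc g /\
  h (RtoC 0) = RtoC 0 /\ C_derive h (RtoC 0) = RtoC 1 /\ g (RtoC 0) = RtoC 0 /\
  forall z : C, unit_disc z -> f z = (h z + Cconj (g z))%C.

Definition diff_op (alpha : R) (k : C -> C) (z : C) : C :=
  (RtoC (1 - alpha) * C_derive k z
   + RtoC alpha * z * C_derive (C_derive k) z)%C.

Definition class_P0 (alpha M : R) (f : C -> C) : Prop :=
  exists h g : C -> C,
    class_H_repr f h g /\ C_derive g (RtoC 0) = RtoC 0 /\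
    forall z : C, unit_disc z ->
      Re (diff_op alpha h z) > - M + Cmod (diff_op alpha g z).

(* The convolution of f = h + conj g with phi, through the parts h and g. *)
Definition harmonic_conv (h g phi : C -> C) (z : C) : C :=
  (hadamard h phi z + Cconj (hadamard g phi z))%C.

(* Main.v *)
Require Import Defs.
From Stdlib Require Import Reals Factorial Lra Lia.
From Coquelicot Require Import Coquelicot.
Open Scope R_scope.

(* Write F and G for the operator applied to h and g, with F shifted by M, so
   that the hypothesis reads |G| < Re F.  The operator acts diagonally on Taylor
   coefficients, hence convolving h and g with phi convolves F and G with
   P(z) = phi(z)/z.  For 0 < rho < 1 the kernel 2 Re P(rho e^it) - 1 is positive
   of mean 1, and averaging F(u e^-it) against it gives (F * P)(rho u); so
   Re (F * P) - |G * P| is bounded below by the minimum of Re F - |G| on the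
   circle |z| = |u|.
   The kernel is only used through its Fourier coefficients.  They are computed
   from local analyticity alone: the mean of a holomorphic function on the circle
   of radius r does not depend on r, so the expansion at the origin suffices.
   This also gives Caratheodory's bound on the coefficients of phi, hence the
   convergence of the convolutions in the whole disc. *)

(** * Complex series and power series *)

Local Notation Cis_series := (@is_series C_AbsRing C_NormedModule).
Local Notation Cis_derive := (@is_derive C_AbsRing C_NormedModule).

(** Analyticity is local here: [h] and [g] come with expansions valid in the whole disc, [phi] does
    not, and the argument never asks for one. The bound 1/2 is exactly positivity of the kernel.
    Writing P as the sum of p_n z^n with p_0 = 1, the function 2 Re P - 1 equals 1 plus twice the
    real part of the terms with n >= 1, so on |z| = rho its Fourier coefficient of index n >= 0 is
    p_n rho^n, without a factor two. Only finite Taylor sections of F and G are integrated, so no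
    series is exchanged with an integral. The truncation errors are absorbed by the positive minimum
    of Re F - |G| on a circle, which also keeps the final inequality strict. The modulus of G * P is
    not linear in G; it is reached through F + e G with |e| = 1, since Re (F + e G) >= Re F - |G|,
    with e adapted to the point under study. Finally, membership in the class is existential in the
    analytic parts, so the inequality is given for a pair that has to be compared with [h] and [g];
    equality of derivatives is enough, as the operator sees nothing else. *)

Lemma Cmod_minus_sym (x y : C) : Cmod (x - y) = Cmod (y - x).
Proof. rewrite <- Cmod_opp. f_equal. ring. Qed.

Lemma im_le_Cmod (c : C) : Rabs (Im c) <= Cmod c.
Proof.
  apply Rle_trans with (2 := Rmax_Cmod c). apply Rmax_r.
Qed.

Lemma Cmod_le_Re_Im (c : C) : Cmod c <= Rabs (Re c) + Rabs (Im c).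
Proof.
  replace c with (RtoC (Re c) + RtoC (Im c) * Ci)%C at 1.
  - apply Rle_trans with (1 := Cmod_triangle _ _).
    rewrite Cmod_mult, Cmod_Ci, !Cmod_R. lra.
  - destruct c as [x y]. unfold Cplus, Cmult, Ci, RtoC; simpl. f_equal; ring.
Qed.

(** Makes a modulus the real part of a linear expression, so that estimates on real parts yield
    estimates on moduli. *)
Lemma Cmod_rotate (z : C) : exists e : C, Cmod e = 1 /\ (e * z)%C = RtoC (Cmod z).
Proof.
  destruct (Ceq_dec z (RtoC 0)) as [-> | Hz].
  - exists (RtoC 1). rewrite Cmod_1, Cmod_0. split; [reflexivity | ring].
  - assert (H := proj1 (Cmod_gt_0 z) Hz).
    assert (Hc : RtoC (Cmod z) <> RtoC 0) by (intro E; injection E; lra).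
    exists (Cconj z / RtoC (Cmod z))%C. split.
    + rewrite Cmod_div, Cmod_conj, Cmod_R, Rabs_pos_eq by (auto; lra).
      field; lra.
    + unfold Cdiv. replace (Cconj z * / RtoC (Cmod z) * z)%C
        with ((z * Cconj z) / RtoC (Cmod z))%C by (unfold Cdiv; ring).
      rewrite <- Cmod2_conj, RtoC_pow. field. exact Hc.
Qed.

Lemma Rle_of_eps (x y K : R) :
  0 <= K -> (forall e, 0 < e -> x <= y + e * K) -> x <= y.
Proof.
  intros HK H. apply Rnot_lt_le. intro Hlt.
  (* Adding 1 to [K] covers [K = 0]; the factor 2 makes the contradiction strict. *)
  assert (He : 0 < (x - y) / (2 * (K + 1))) by (apply Rdiv_lt_0_compat; lra).
  specialize (H _ He).
  assert ((x - y) / (2 * (K + 1)) * K < x - y); [ | lra].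
  replace (x - y) with ((x - y) / (2 * (K + 1)) * (2 * (K + 1))) at 2 by (field; lra).
  apply Rmult_lt_compat_l; lra.
Qed.

(** Balls of [C_NormedModule] are products of real balls, so convergence is componentwise. This is
    the bridge to [CSeries], which is built from two real series. *)
Lemma is_series_Re_Im (u : nat -> C) (l : C) :
  Cis_series u l <->
  is_series (fun n => Re (u n)) (Re l) /\ is_series (fun n => Im (u n)) (Im l).
Proof.
  assert (HR : forall n, Re (@sum_n C_AbelianMonoid u n) = sum_n (fun k => Re (u k)) n).
  { induction n; [now rewrite !sum_O|]. rewrite !sum_Sn, <- IHn. reflexivity. }
  assert (HI : forall n, Im (@sum_n C_AbelianMonoid u n) = sum_n (fun k => Im (u k)) n).
  { induction n; [now rewrite !sum_O|]. rewrite !sum_Sn, <- IHn. reflexivity. }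
  unfold is_series. split.
  - intros H. split; apply filterlim_locally; intros eps;
      generalize (proj1 (filterlim_locally _ _) H eps); apply filter_imp; intros n [H1 H2].
    + rewrite <- HR. exact H1.
    + rewrite <- HI. exact H2.
  - intros [H1 H2]. apply filterlim_locally. intros eps.
    generalize (filter_and _ _ (proj1 (filterlim_locally _ _) H1 eps)
                  (proj1 (filterlim_locally _ _) H2 eps)).
    apply filter_imp. intros n [K1 K2]. rewrite <- HR in K1. rewrite <- HI in K2.
    split; assumption.
Qed.

Lemma is_series_CSeries (u : nat -> C) :
  ex_series (fun n => Cmod (u n)) -> Cis_series u (CSeries u).
Proof.
  intros H. apply is_series_Re_Im. simpl.
  split; apply Series_correct, ex_series_Rabs.
  - apply (ex_series_le (K := R_AbsRing) (V := R_CompleteNormedModule)) with (2 := H). intros n.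
    unfold norm; simpl. unfold abs; simpl. rewrite Rabs_Rabsolu. apply re_le_Cmod.
  - apply (ex_series_le (K := R_AbsRing) (V := R_CompleteNormedModule)) with (2 := H). intros n.
    unfold norm; simpl. unfold abs; simpl. rewrite Rabs_Rabsolu. apply im_le_Cmod.
Qed.

Lemma CSeries_unique (u : nat -> C) (l : C) : Cis_series u l -> CSeries u = l.
Proof.
  intros H. apply is_series_Re_Im in H. destruct H as [H1 H2].
  unfold CSeries. rewrite (is_series_unique _ _ H1), (is_series_unique _ _ H2).
  now destruct l.
Qed.

Lemma is_series_C_unique (u : nat -> C) (l1 l2 : C) :
  Cis_series u l1 -> Cis_series u l2 -> l1 = l2.
Proof.
  intros H1 H2. now rewrite <- (CSeries_unique _ _ H1), <- (CSeries_unique _ _ H2).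
Qed.

Lemma is_series_R_le (u v : nat -> R) (a b : R) :
  (forall n, u n <= v n) -> is_series u a -> is_series v b -> a <= b.
Proof.
  intros H Hu Hv.
  refine (is_lim_seq_le (sum_n u) (sum_n v) a b _ Hu Hv).
  intros n. now apply sum_n_m_le.
Qed.

Lemma is_series_C_scal (a : C) (u : nat -> C) (l : C) :
  Cis_series u l -> Cis_series (fun n => a * u n)%C (a * l)%C.
Proof. intros H. exact (is_series_scal (K := C_AbsRing) (V := C_NormedModule) a u l H). Qed.

Lemma is_series_C_plus (u v : nat -> C) (a b : C) :
  Cis_series u a -> Cis_series v b -> Cis_series (fun n => u n + v n)%C (a + b)%C.
Proof. intros H1 H2. exact (is_series_plus (K := C_AbsRing) (V := C_NormedModule) u v a b H1 H2). Qed.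

Lemma is_series_C_ext (u v : nat -> C) (l : C) :
  (forall n, u n = v n) -> Cis_series u l -> Cis_series v l.
Proof. intros H1 H2. exact (is_series_ext (K := C_AbsRing) (V := C_NormedModule) u v l H1 H2). Qed.

(** Rotating the sum onto the nonnegative real axis reduces the claim to termwise comparison of real
    series. *)
Lemma is_series_Cmod_le (u : nat -> C) (v : nat -> R) (l : C) (b : R) :
  (forall n, Cmod (u n) <= v n) -> Cis_series u l -> is_series v b -> Cmod l <= b.
Proof.
  intros H Hu Hv. destruct (Cmod_rotate l) as [e [He Hl]].
  apply (is_series_C_scal e) in Hu. rewrite Hl in Hu.
  apply is_series_Re_Im in Hu. destruct Hu as [Hu _].
  refine (is_series_R_le _ _ _ _ _ Hu Hv). intros n.
  apply Rle_trans with (2 := H n). apply Rle_trans with (1 := Rle_abs _).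
  apply Rle_trans with (1 := re_le_Cmod _). rewrite Cmod_mult, He. lra.
Qed.

Lemma is_series_C_shift (u : nat -> C) (l : C) :
  Cis_series u l <-> Cis_series (fun n => u (S n)) (l - u 0%nat)%C.
Proof.
  split; intros H.
  - apply (is_series_incr_1 (K := C_AbsRing) (V := C_NormedModule) u).
    replace (@plus (NormedModule.AbelianMonoid C_AbsRing C_NormedModule) (l - u 0%nat)%C (u 0%nat)) with l; [exact H | ].
    change (l = ((l - u 0%nat) + u 0%nat)%C). ring.
  - apply (is_series_decr_1 (K := C_AbsRing) (V := C_NormedModule) u). exact H.
Qed.

Lemma is_series_C_zero : Cis_series (fun _ => RtoC 0) (RtoC 0).
Proof.
  apply is_series_Re_Im. simpl.
  split; apply is_series_Reals; intros e He; exists 0%nat; intros n _;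
    rewrite (sum_eq_R0 (fun _ => 0)) by auto; rewrite R_dist_eq; exact He.
Qed.

(** The upper index is excluded, unlike in [sum_n]: a section of length K of a power series leaves a
    remainder of order K. *)
Fixpoint Csum (u : nat -> C) (n : nat) : C :=
  match n with O => RtoC 0 | S m => (Csum u m + u m)%C end.

Lemma Csum_sum_n (u : nat -> C) (n : nat) : Csum u (S n) = @sum_n C_AbelianMonoid u n.
Proof.
  induction n.
  - rewrite sum_O. simpl. ring.
  - rewrite sum_Sn, <- IHn. reflexivity.
Qed.

Lemma Csum_ext (u v : nat -> C) (n : nat) :
  (forall k, (k < n)%nat -> u k = v k) -> Csum u n = Csum v n.
Proof.
  induction n; simpl; intros H; [reflexivity | ].
  rewrite IHn by (intros; apply H; lia). now rewrite H by lia.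
Qed.

Lemma Csum_scal (a : C) (u : nat -> C) (n : nat) :
  Csum (fun k => a * u k)%C n = (a * Csum u n)%C.
Proof. induction n; simpl; [ring | rewrite IHn; ring]. Qed.

Lemma Csum_shift (u : nat -> C) (n : nat) :
  Csum u (S n) = (u 0%nat + Csum (fun k => u (S k)) n)%C.
Proof. induction n; [simpl; ring|]. simpl in *. rewrite IHn. ring. Qed.

Lemma is_series_C_of_partial (u : nat -> C) (l : C) :
  (forall e, 0 < e -> exists N, forall n, (N <= n)%nat -> Cmod (Csum u n - l) < e) ->
  Cis_series u l.
Proof.
  intros H. apply filterlim_locally. intros eps.
  destruct (H eps (cond_pos eps)) as [N HN]. exists N. intros n Hn.
  apply (norm_compat1 (K := C_AbsRing) (V := C_NormedModule)).
  rewrite <- Csum_sum_n. apply HN. lia.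
Qed.

Lemma is_series_C_partial (u : nat -> C) (l : C) :
  Cis_series u l ->
  forall e, 0 < e -> exists N, forall n, (N <= n)%nat -> Cmod (Csum u n - l) < e.
Proof.
  intros H e He.
  assert (H1 := proj1 (filterlim_locally_ball_norm (K:=C_AbsRing) (U := C_NormedModule) _ _) H (mkposreal e He)).
  destruct H1 as [N HN]. exists (S N). intros [|n] Hn; [lia | ].
  rewrite Csum_sum_n. apply HN. lia.
Qed.

(** * Power series: absolute convergence and change of centre *)

Definition abs_summable (c : nat -> C) (r : R) : Prop :=
  ex_series (fun n => Cmod (c n) * r ^ n).

(** The centre is always the origin; an expansion at [z] is expressed through the translate
    [fun w => f (z + w)]. *)
Definition power_sum (f : C -> C) (c : nat -> C) (r : R) : Prop :=
  forall z, Cmod z < r -> Cis_series (fun n => c n * z ^ n)%C (f z).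

Lemma is_pseries_C (c : nat -> C) (z l : C) :
  @is_pseries C_AbsRing C_NormedModule c z l <-> Cis_series (fun n => c n * z ^ n)%C l.
Proof.
  split; apply (is_series_ext (K := C_AbsRing) (V := C_NormedModule));
    intros n; [change (z ^ n * c n = c n * z ^ n)%C | change (c n * z ^ n = z ^ n * c n)%C]; ring.
Qed.

Lemma is_series_C_bounded (u : nat -> C) (l : C) :
  Cis_series u l -> exists B, forall n, Cmod (u n) <= B.
Proof.
  intros H. destruct (is_series_C_partial _ _ H 1 Rlt_0_1) as [N HN].
  assert (Hf : forall m, exists B, forall n, (n < m)%nat -> Cmod (u n) <= B).
  { induction m as [|m [B HB]]; [exists 0; intros; lia | ].
    exists (Rmax B (Cmod (u m))). intros n Hn.
    destruct (Nat.eq_dec n m) as [-> | ]; [apply Rmax_r | ].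
    apply Rle_trans with (2 := Rmax_l _ _). apply HB. lia. }
  destruct (Hf N) as [B HB]. exists (Rmax B 2). intros n.
  destruct (Nat.lt_ge_cases n N).
  - apply Rle_trans with (2 := Rmax_l _ _). auto.
  - apply Rle_trans with (2 := Rmax_r _ _).
    (* A late term is a difference of two partial sums, each within 1 of the limit; hence the bound
       2. *)
    replace (u n) with ((Csum u (S n) - l) + (- (Csum u n - l)))%C by (simpl; ring).
    apply Rle_trans with (1 := Cmod_triangle _ _). rewrite Cmod_opp.
    assert (H1 := HN n ltac:(lia)). assert (H2 := HN (S n) ltac:(lia)). lra.
Qed.

(** Abel's lemma: the terms are dominated by a geometric series of ratio r/s. *)
Lemma abs_summable_of_bounded (c : nat -> C) (B s r : R) :
  0 <= r < s -> (forall n, Cmod (c n) * s ^ n <= B) -> abs_summable c r.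
Proof.
  intros Hr H.
  assert (HB : ex_series (fun n => B * (r / s) ^ n)).
  { apply (ex_series_scal (K := R_AbsRing) (V := R_NormedModule) B (pow (r / s))).
    apply ex_series_geom.
    rewrite Rabs_pos_eq by (apply Rle_div_r; lra).
    apply Rlt_div_l; lra. }
  apply (ex_series_le (K := R_AbsRing) (V := R_CompleteNormedModule)) with (2 := HB).
  intros n. unfold norm; simpl; unfold abs; simpl.
  assert (0 <= r ^ n) by (apply pow_le; lra). assert (0 < s ^ n) by (apply pow_lt; lra).
  rewrite Rabs_pos_eq by (apply Rmult_le_pos; [apply Cmod_ge_0 | auto]).
  unfold Rdiv. rewrite Rpow_mult_distr, pow_inv.
  replace (Cmod (c n) * r ^ n) with (Cmod (c n) * s ^ n * (r ^ n * / s ^ n)) by (field; lra).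
  apply Rmult_le_compat_r; [ | apply H].
  apply Rmult_le_pos; [auto | apply Rlt_le, Rinv_0_lt_compat; auto].
Qed.

Lemma Cmod_RtoC_pos (r : R) : 0 <= r -> Cmod (RtoC r) = r.
Proof. intros. rewrite Cmod_R. now apply Rabs_pos_eq. Qed.

Lemma power_sum_abs_summable (f : C -> C) (c : nat -> C) (R0 r : R) :
  power_sum f c R0 -> 0 <= r < R0 -> abs_summable c r.
Proof.
  intros Hf Hr.
  assert (Hs : Cmod (RtoC ((r + R0) / 2)) = (r + R0) / 2) by (apply Cmod_RtoC_pos; lra).
  (* Convergence at a radius strictly between [r] and [R0] gives the bounded terms that Abel's lemma
     needs. *)
  destruct (is_series_C_bounded _ _ (Hf (RtoC ((r + R0) / 2)) ltac:(lra))) as [B HB].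
  apply abs_summable_of_bounded with B ((r + R0) / 2); [lra | ].
  intros n. specialize (HB n). now rewrite Cmod_mult, Cmod_pow, Hs in HB.
Qed.

Lemma abs_summable_power_sum (c : nat -> C) (R0 : R) :
  (forall r, 0 <= r < R0 -> abs_summable c r) ->
  power_sum (fun z => CSeries (fun n => c n * z ^ n)%C) c R0.
Proof.
  intros H z Hz. apply is_series_CSeries.
  apply ex_series_ext with (2 := H (Cmod z) (conj (Cmod_ge_0 z) Hz)).
  intros n. now rewrite Cmod_mult, Cmod_pow.
Qed.

(* The coefficient of [w^k] in [(z + w)^n], by Pascal's rule. *)
Fixpoint shift_coeff (z : C) (n k : nat) : C :=
  match n with
  | O => match k with O => RtoC 1 | S _ => RtoC 0 end
  | S n' => (z * shift_coeff z n' k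
             + match k with O => RtoC 0 | S k' => shift_coeff z n' k' end)%C
  end.

Lemma shift_coeff_0 (z : C) (n : nat) : shift_coeff z n 0 = (z ^ n)%C.
Proof. induction n; [reflexivity | ]. simpl. rewrite IHn. ring. Qed.

Lemma shift_coeff_1 (z : C) (n : nat) :
  shift_coeff z (S n) 1 = (RtoC (INR (S n)) * z ^ n)%C.
Proof.
  induction n.
  - simpl. ring.
  - change (shift_coeff z (S (S n)) 1)
      with (z * shift_coeff z (S n) 1 + shift_coeff z (S n) 0)%C.
    rewrite IHn, shift_coeff_0. rewrite (S_INR (S n)), RtoC_plus, Cpow_S. ring.
Qed.

(** The left side is at most one summand in the expansion of (|z| + t)^n, whose summands are all
    nonnegative. The induction follows Pascal's rule. *)
Lemma shift_coeff_bound (z : C) (t : R) (n k : nat) :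
  0 <= t -> Cmod (shift_coeff z n k) * t ^ k <= (Cmod z + t) ^ n.
Proof.
  intros Ht. revert k. induction n; intros k; simpl.
  - destruct k; [rewrite Cmod_1 | rewrite Cmod_0]; simpl; lra.
  - assert (Hk := pow_le t k Ht). assert (Hz := Cmod_ge_0 z).
    apply Rle_trans with (Cmod z * (Cmod (shift_coeff z n k) * t ^ k)
      + Cmod (match k with O => RtoC 0 | S k' => shift_coeff z n k' end) * t ^ k).
    + rewrite <- Rmult_assoc, <- Rmult_plus_distr_r, <- Cmod_mult.
      apply Rmult_le_compat_r; [auto | apply Cmod_triangle].
    + rewrite Rmult_plus_distr_r. apply Rplus_le_compat.
      * apply Rmult_le_compat_l; auto.
      * destruct k as [|k].
        -- rewrite Cmod_0, Rmult_0_l. apply Rmult_le_pos; [auto | apply pow_le; lra].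
        -- simpl. specialize (IHn k).
           replace (Cmod (shift_coeff z n k) * (t * t ^ k))
             with (t * (Cmod (shift_coeff z n k) * t ^ k)) by ring.
           apply Rmult_le_compat_l; auto.
Qed.

(** The terms of degree j >= K carry |w|^j <= q^K t^j. The factor q^K does not depend on [n], so the
    bound can later be summed against the coefficients without exchanging a double sum. *)
Lemma shift_remainder_bound (z w : C) (t q : R) (n K : nat) :
  0 <= t -> 0 <= q <= 1 -> Cmod w <= q * t ->
  Cmod ((z + w) ^ n - Csum (fun k => shift_coeff z n k * w ^ k) K)%C
    <= q ^ K * (Cmod z + t) ^ n.
Proof.
  intros Ht Hq Hw. assert (Hz := Cmod_ge_0 z). revert K.
  assert (H0 : forall n, Cmod ((z + w) ^ n)%C <= (Cmod z + t) ^ n).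
  { intros m. rewrite Cmod_pow. apply pow_incr. split; [apply Cmod_ge_0 | ].
    apply Rle_trans with (1 := Cmod_triangle _ _).
    assert (q * t <= 1 * t) by (apply Rmult_le_compat_r; lra). lra. }
  assert (H1 : forall n, Cmod ((z + w) ^ n - RtoC 0)%C <= 1 * (Cmod z + t) ^ n).
  { intros m. rewrite Rmult_1_l. replace ((z + w) ^ m - 0)%C with ((z + w) ^ m)%C by ring.
    apply H0. }
  induction n; intros [|K]; try apply H1.
  - rewrite Csum_shift. rewrite (Csum_ext _ (fun _ => RtoC 0 * RtoC 0)%C), Csum_scal by (intros; simpl; ring).
    simpl. replace (1 - (1 * 1 + 0 * Csum (fun _ => 0) K))%C with (RtoC 0) by ring.
    rewrite Cmod_0. assert (0 <= q ^ K) by (apply pow_le; lra).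
    rewrite Rmult_1_r. apply Rmult_le_pos; lra.
  (* Pascal's rule for remainders: multiplying by z + w gives z times the remainder of the same
     length plus w times the one shorter by one, which is why the induction keeps [K] general. *)
  - replace ((z + w) ^ S n - Csum (fun k => shift_coeff z (S n) k * w ^ k) (S K))%C
      with (z * ((z + w) ^ n - Csum (fun k => shift_coeff z n k * w ^ k) (S K))
            + w * ((z + w) ^ n - Csum (fun k => shift_coeff z n k * w ^ k) K))%C.
    + apply Rle_trans with (1 := Cmod_triangle _ _). rewrite !Cmod_mult.
      simpl (_ ^ S _).
      replace (q * q ^ K * ((Cmod z + t) * (Cmod z + t) ^ n))
        with (Cmod z * (q ^ S K * (Cmod z + t) ^ n)
              + (q * t) * (q ^ K * (Cmod z + t) ^ n)) by (simpl; ring).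
      apply Rplus_le_compat.
      * apply Rmult_le_compat_l; [auto | apply IHn].
      * apply Rmult_le_compat; [apply Cmod_ge_0 .. | auto | apply IHn].
    + rewrite (Csum_shift (fun k => shift_coeff z (S n) k * w ^ k)%C).
      rewrite (Csum_shift (fun k => shift_coeff z n k * w ^ k)%C).
      rewrite (Csum_ext (fun k => shift_coeff z (S n) (S k) * w ^ S k)%C
        (fun k => z * (shift_coeff z n (S k) * w ^ S k) + w * (shift_coeff z n k * w ^ k))%C)
        by (intros; simpl; ring).
      assert (E : forall u v m, Csum (fun k => u k + v k)%C m = (Csum u m + Csum v m)%C).
      { intros u v. induction m; simpl; [ring | rewrite IHm; ring]. }
      rewrite E, !Csum_scal. simpl. ring.
Qed.

(* The coefficients at [z] of the function with coefficients [c] at the origin. *)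
Definition shifted (c : nat -> C) (z : C) (k : nat) : C :=
  CSeries (fun n => c n * shift_coeff z n k)%C.

(** The margin [t] beyond |z| pays for the binomial coefficients: the terms are dominated by t^(-k)
    |c n| (|z| + t)^n. *)
Lemma is_series_shifted (c : nat -> C) (z : C) (t : R) (k : nat) :
  0 < t -> abs_summable c (Cmod z + t) ->
  Cis_series (fun n => c n * shift_coeff z n k)%C (shifted c z k).
Proof.
  intros Ht H. apply is_series_CSeries.
  apply (ex_series_le (K := R_AbsRing) (V := R_CompleteNormedModule))
    with (b := fun n => / t ^ k * (Cmod (c n) * (Cmod z + t) ^ n)).
  - intros n. unfold norm; simpl; unfold abs; simpl.
    rewrite Rabs_pos_eq by apply Cmod_ge_0. rewrite Cmod_mult.
    assert (0 < t ^ k) by now apply pow_lt.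
    replace (Cmod (c n) * Cmod (shift_coeff z n k))
      with (/ t ^ k * (Cmod (c n) * (Cmod (shift_coeff z n k) * t ^ k))) by (field; lra).
    apply Rmult_le_compat_l; [apply Rlt_le, Rinv_0_lt_compat; auto | ].
    apply Rmult_le_compat_l; [apply Cmod_ge_0 | ].
    apply shift_coeff_bound. lra.
  - exact (ex_series_scal (K := R_AbsRing) (V := R_NormedModule) _ _ H).
Qed.

(** Obtained by summing the remainder bounds of single powers, with B the sum of |c n| (|z| + t)^n.
    It is used in two regimes: q < 1 with K growing gives convergence of the new expansion, uniform
    for fixed q; fixed K with q = |w|/t gives a remainder of order |w|^K. *)
Lemma power_sum_taylor_bound (f : C -> C) (c : nat -> C) (R0 : R) (z : C) (t : R) :
  power_sum f c R0 -> 0 < t -> Cmod z + t < R0 ->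
  exists B, 0 <= B /\ forall q w K, 0 <= q <= 1 -> Cmod w <= q * t ->
    Cmod (f (z + w) - Csum (fun k => shifted c z k * w ^ k) K)%C <= q ^ K * B.
Proof.
  intros Hf Ht Hz. assert (Hz0 := Cmod_ge_0 z).
  assert (Hc := power_sum_abs_summable f c R0 (Cmod z + t) Hf ltac:(lra)).
  assert (HB := Series_correct _ Hc).
  exists (Series (fun n => Cmod (c n) * (Cmod z + t) ^ n)). split.
  { refine (is_series_R_le _ _ _ _ _
      (proj1 (proj1 (is_series_Re_Im _ _) is_series_C_zero)) HB).
    intros n. apply Rmult_le_pos; [apply Cmod_ge_0 | apply pow_le; lra]. }
  intros q w K Hq Hw.
  assert (Hw' : Cmod w <= t).
  { assert (q * t <= 1 * t) by (apply Rmult_le_compat_r; lra). lra. }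
  assert (HS : Cis_series (fun n => c n * Csum (fun k => shift_coeff z n k * w ^ k) K)%C
                 (Csum (fun k => shifted c z k * w ^ k) K)%C).
  { clear -Ht Hc. induction K; simpl.
    - apply is_series_C_ext with (2 := is_series_C_zero). intros; ring.
    - apply is_series_C_ext with
       (fun n => c n * Csum (fun k => shift_coeff z n k * w ^ k) K
                 + w ^ K * (c n * shift_coeff z n K))%C; [intros; simpl; ring | ].
      apply is_series_C_plus; [exact IHK | ].
      rewrite (Cmult_comm (shifted c z K)).
      apply is_series_C_scal. apply is_series_shifted with t; auto. }
  apply (is_series_C_scal (RtoC (-1))) in HS.
  assert (HF := Hf (z + w)%C ltac:(apply Rle_lt_trans with (1 := Cmod_triangle _ _); lra)).
  assert (HD := is_series_C_plus _ _ _ _ HF HS).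
  replace (f (z + w) - Csum (fun k => shifted c z k * w ^ k) K)%C
    with (f (z + w) + RtoC (-1) * Csum (fun k => shifted c z k * w ^ k) K)%C by ring.
  refine (is_series_Cmod_le _ _ _ _ _ HD (is_series_scal (K := R_AbsRing) (V := R_NormedModule) (q ^ K) _ _ HB)).
  intros n.
  replace (c n * (z + w) ^ n + RtoC (-1) * (c n * Csum (fun k => shift_coeff z n k * w ^ k) K))%C
    with (c n * ((z + w) ^ n - Csum (fun k => shift_coeff z n k * w ^ k) K))%C by ring.
  rewrite Cmod_mult.
  change (Cmod (c n) * Cmod ((z + w) ^ n - Csum (fun k => shift_coeff z n k * w ^ k) K)%C
          <= q ^ K * (Cmod (c n) * (Cmod z + t) ^ n)).
  replace (q ^ K * (Cmod (c n) * (Cmod z + t) ^ n))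
    with (Cmod (c n) * (q ^ K * (Cmod z + t) ^ n)) by ring.
  apply Rmult_le_compat_l; [apply Cmod_ge_0 | ].
  apply shift_remainder_bound; auto; lra.
Qed.

Lemma power_sum_recenter (f : C -> C) (c : nat -> C) (R0 : R) (z : C) :
  power_sum f c R0 -> Cmod z < R0 ->
  power_sum (fun w => f (z + w)%C) (shifted c z) (R0 - Cmod z).
Proof.
  intros Hf Hz w Hw. assert (Hw0 := Cmod_ge_0 w).
  (* The midpoint of |w| and R0 - |z|, so that |w|/t < 1 while |z| + t < R0. *)
  set (t := (R0 - Cmod z + Cmod w) / 2).
  assert (Ht : Cmod w < t < R0 - Cmod z) by (unfold t; lra).
  destruct (power_sum_taylor_bound f c R0 z t Hf ltac:(lra) ltac:(lra)) as [B [HB H]].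
  apply is_series_C_of_partial. intros e He.
  assert (Hq : 0 <= Cmod w / t < 1) by (split; [apply Rle_div_r | apply Rlt_div_l]; lra).
  destruct (pow_lt_1_zero (Cmod w / t) ltac:(rewrite Rabs_pos_eq; lra) (e / (B + 1))) as [N HN].
  { apply Rdiv_lt_0_compat; lra. }
  exists N. intros n Hn. rewrite Cmod_minus_sym.
  apply Rle_lt_trans with (1 := H (Cmod w / t) w n ltac:(lra) ltac:(right; field; lra)).
  specialize (HN n ltac:(lia)). assert (Hp := pow_le _ n (proj1 Hq)).
  rewrite Rabs_pos_eq in HN by auto.
  apply Rle_lt_trans with ((Cmod w / t) ^ n * (B + 1)).
  - apply Rmult_le_compat_l; lra.
  - apply (Rmult_lt_compat_r (B + 1)) in HN; [ | lra].
    replace (e / (B + 1) * (B + 1)) with e in HN by (field; lra). exact HN.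
Qed.

(** * Complex derivatives of power series *)

(* Products of derivatives are available in Coquelicot only for this module, whose
   topology on C is not convertible to that of [C_NormedModule] in [C_derive]. *)
Local Notation Cring := (AbsRing_NormedModule C_AbsRing).

(** The common form to which differentiability for both modules is reduced; rules proved for one
    thus become available for the other. *)
Definition C_first_order (f : C -> C) (z l : C) : Prop :=
  forall e, 0 < e -> exists d, 0 < d /\
    forall w, Cmod w < d -> Cmod (f (z + w) - f z - l * w)%C <= e * Cmod w.

(** The target module enters differentiability only through its operations and its norm, which agree
    in both cases, so one script proves both equivalences. *)
Ltac unfold_C_derivative :=
  split;
  [ intros [_ H] e He;
    destruct (H _ (fun P HP => HP) (mkposreal e He)) as [d Hd];
    exists d; split; [apply cond_pos | ]; intros w Hw;
    match goal with |- Cmod (?f (?z + w) - _ - ?l * w)%C <= _ =>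
      assert (E : (z + w - z)%C = w) by ring;
      assert (Hb : Cmod (z + w - z)%C < d) by (rewrite E; exact Hw);
      specialize (Hd (z + w)%C Hb);
      change (Cmod (f (z + w) - f z - (z + w - z) * l)%C <= e * Cmod (z + w - z)%C) in Hd;
      now rewrite E, (Cmult_comm w) in Hd
    end
  | intros H; split; [apply is_linear_scal_l | ];
    intros x Hx; apply (is_filter_lim_locally_unique (K := C_AbsRing) (V := Cring)) in Hx;
    subst x; intros eps;
    assert (Ey : forall a b : C, (a + (b - a))%C = b) by (intros; ring); destruct (H eps (cond_pos eps)) as [d [Hd H1]];
    exists (mkposreal d Hd); intros y Hy;
    match type of H with C_first_order _ ?z ?l =>
      specialize (H1 (y - z)%C Hy); rewrite (Cmult_comm l) in H1;
      rewrite Ey in H1; exact H1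
    end ].

Lemma is_derive_C_iff (f : C -> C) (z l : C) :
  Cis_derive f z l <-> C_first_order f z l.
Proof. unfold_C_derivative. Qed.

Lemma is_derive_Cring_iff (f : C -> C) (z l : C) :
  is_derive (V := Cring) f z l <-> C_first_order f z l.
Proof. unfold_C_derivative. Qed.

Lemma first_order_C_derive (f : C -> C) (z l : C) :
  C_first_order f z l -> C_derive f z = l.
Proof. intros H. now apply is_C_derive_unique, is_derive_C_iff. Qed.

Lemma first_order_ext_ball (f g : C -> C) (z l : C) (r : R) :
  0 < r -> (forall w, Cmod w < r -> f (z + w)%C = g (z + w)%C) ->
  C_first_order f z l -> C_first_order g z l.
Proof.
  intros Hr H Hf e He. destruct (Hf e He) as [d [Hd H1]].
  exists (Rmin d r). split; [now apply Rmin_glb_lt | ].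
  intros w Hw. rewrite <- H by (apply Rlt_le_trans with (1 := Hw), Rmin_r).
  replace (g z) with (f z).
  - apply H1. apply Rlt_le_trans with (1 := Hw), Rmin_l.
  - replace z with (z + RtoC 0)%C by ring. apply H. now rewrite Cmod_0.
Qed.

Lemma first_order_translate (f : C -> C) (z w l : C) :
  C_first_order (fun v => f (z + v)%C) w l <-> C_first_order f (z + w)%C l.
Proof.
  split; intros H e He; destruct (H e He) as [d [Hd H1]]; exists d; split; auto;
    intros v Hv; specialize (H1 v Hv).
  - now replace (z + w + v)%C with (z + (w + v))%C by ring.
  - now replace (z + (w + v))%C with (z + w + v)%C by ring.
Qed.

(** The remainder bound with K = 2 and q = |w|/t is quadratic in |w|. *)
Lemma power_sum_first_order (f : C -> C) (c : nat -> C) (R0 : R) (z : C) :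
  power_sum f c R0 -> Cmod z < R0 -> C_first_order f z (shifted c z 1).
Proof.
  intros Hf Hz e He. set (t := (R0 - Cmod z) / 2).
  assert (Ht : 0 < t) by (unfold t; lra).
  destruct (power_sum_taylor_bound f c R0 z t Hf Ht ltac:(unfold t; lra)) as [B [HB H]].
  assert (E : f z = shifted c z 0).
  { apply is_series_C_unique with (fun n => c n * z ^ n)%C; [now apply Hf | ].
    apply is_series_C_ext with (fun n => c n * shift_coeff z n 0)%C.
    - intros n. now rewrite shift_coeff_0.
    - apply is_series_shifted with t; [exact Ht | ].
      apply power_sum_abs_summable with f R0; [exact Hf | ].
      assert (H0 := Cmod_ge_0 z). unfold t in *; lra. }
  (* The second radius gives |w| B / t^2 <= e; B + 1 keeps the denominator positive. *)
  exists (Rmin t (e * t ^ 2 / (B + 1))). split.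
  { apply Rmin_glb_lt; [exact Ht | ]. apply Rdiv_lt_0_compat; [ | lra].
    apply Rmult_lt_0_compat; [lra | now apply pow_lt]. }
  intros w Hw. assert (Hw0 := Cmod_ge_0 w).
  assert (Hw1 := Rlt_le_trans _ _ _ Hw (Rmin_l _ _)).
  assert (Hw2 := Rlt_le_trans _ _ _ Hw (Rmin_r _ _)).
  specialize (H (Cmod w / t) w 2%nat).
  replace (f (z + w) - f z - shifted c z 1 * w)%C
    with (f (z + w) - Csum (fun k => shifted c z k * w ^ k) 2)%C
    by (simpl; rewrite E; ring).
  apply Rle_trans with (1 := H ltac:(split; [apply Rle_div_r | apply Rlt_le, Rlt_div_l]; lra)
                                 ltac:(right; field; lra)).
  replace ((Cmod w / t) ^ 2 * B) with (Cmod w * B / t ^ 2 * Cmod w) by (field; lra).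
  apply Rmult_le_compat_r; [exact Hw0 | ].
  assert (Ht2 : 0 < t ^ 2) by now apply pow_lt.
  apply Rle_div_l; [lra | ].
  apply Rlt_div_r in Hw2; [ | lra].
  apply Rle_trans with (Cmod w * (B + 1)); [apply Rmult_le_compat_l; lra | lra].
Qed.

Definition derived (c : nat -> C) (n : nat) : C := (RtoC (INR (S n)) * c (S n))%C.

(** The linear binomial coefficient of (z + w)^n is n z^(n-1), so [shifted c z 1] is already the
    termwise derivative; its term n = 0 vanishes and the index moves by one. *)
Lemma power_sum_derive (f : C -> C) (c : nat -> C) (R0 : R) :
  power_sum f c R0 -> power_sum (C_derive f) (derived c) R0.
Proof.
  intros Hf z Hz. rewrite (first_order_C_derive _ _ _ (power_sum_first_order f c R0 z Hf Hz)).
  set (t := (R0 - Cmod z) / 2). assert (H0 := Cmod_ge_0 z).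
  assert (H := is_series_shifted c z t 1 ltac:(unfold t; lra)
    (power_sum_abs_summable f c R0 (Cmod z + t) Hf ltac:(unfold t; lra))).
  apply is_series_C_shift in H. simpl (shift_coeff z 0 1) in H.
  replace (shifted c z 1 - c 0%nat * 0)%C with (shifted c z 1) in H by ring.
  apply is_series_C_ext with (2 := H). intros n. unfold derived.
  rewrite shift_coeff_1. ring.
Qed.

Lemma power_sum_at_0 (f : C -> C) (c : nat -> C) (R0 : R) :
  0 < R0 -> power_sum f c R0 -> f (RtoC 0) = c 0%nat.
Proof.
  intros HR Hf. apply is_series_C_unique with (fun n => c n * RtoC 0 ^ n)%C.
  - apply Hf. now rewrite Cmod_0.
  - apply is_series_C_shift. apply is_series_C_ext with (fun _ => RtoC 0).
    + intros n. simpl. ring.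
    + replace (c 0%nat - c 0%nat * 0 ^ 0)%C with (RtoC 0) by (simpl; ring).
      apply is_series_C_zero.
Qed.

Lemma power_sum_taylor (f : C -> C) (c : nat -> C) (R0 : R) (n : nat) :
  0 < R0 -> power_sum f c R0 -> taylor_coeff f n = c n.
Proof.
  intros HR Hf. unfold taylor_coeff.
  assert (H : C_derive_n f n (RtoC 0) = (RtoC (INR (fact n)) * c n)%C).
  { revert f c Hf. induction n; intros f c Hf.
    - simpl. rewrite (power_sum_at_0 f c R0 HR Hf). ring.
    (* One derivative is moved innermost, so that the induction hypothesis applies to [C_derive f]
       with its own coefficients. *)
    - unfold C_derive_n. rewrite Nat.iter_succ_r.
      change (C_derive_n (C_derive f) n (RtoC 0) = RtoC (INR (fact (S n))) * c (S n))%C.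
      rewrite (IHn _ _ (power_sum_derive f c R0 Hf)). unfold derived.
      rewrite fact_simpl, mult_INR, RtoC_mult. ring. }
  rewrite H. field. intros E. injection E. apply INR_fact_neq_0.
Qed.

Lemma power_sum_derive_0 (f : C -> C) (c : nat -> C) (R0 : R) :
  0 < R0 -> power_sum f c R0 -> C_derive f (RtoC 0) = c 1%nat.
Proof.
  intros HR Hf. rewrite (power_sum_at_0 _ _ R0 HR (power_sum_derive f c R0 Hf)).
  unfold derived. simpl. ring.
Qed.

Lemma power_sum_ext (f g : C -> C) (c : nat -> C) (R0 : R) :
  (forall z, Cmod z < R0 -> f z = g z) -> power_sum f c R0 -> power_sum g c R0.
Proof. intros H Hf z Hz. rewrite <- H by exact Hz. now apply Hf. Qed.

Lemma analytic_at_iff (f : C -> C) (z : C) :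
  analytic_at f z <->
  exists c r, 0 < r /\ power_sum (fun w => f (z + w)%C) c r.
Proof.
  split; intros [c [r [Hr H]]]; exists c, r; split; auto.
  - intros w Hw. apply is_pseries_C.
    replace w with ((z + w) - z)%C at 1 by ring. apply H.
    now replace ((z + w) - z)%C with w by ring.
  - intros w Hw. apply is_pseries_C. specialize (H (w - z)%C Hw). simpl in H.
    now replace (z + (w - z))%C with w in H by ring.
Qed.

Lemma power_sum_analytic (f : C -> C) (c : nat -> C) :
  power_sum f c 1 -> analytic_in_disc f.
Proof.
  intros Hf z Hz. apply analytic_at_iff. exists (shifted c z), (1 - Cmod z).
  unfold unit_disc in Hz. split; [lra | now apply power_sum_recenter].
Qed.

(** Upgrades [C_derive], a limit along real increments, to a derivative in all complex
    directions. *)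
Lemma analytic_at_first_order (f : C -> C) (z : C) :
  analytic_at f z -> C_first_order f z (C_derive f z).
Proof.
  intros H. apply analytic_at_iff in H. destruct H as [c [r [Hr H]]].
  assert (H1 := power_sum_first_order _ c r (RtoC 0) H ltac:(now rewrite Cmod_0)).
  apply first_order_translate in H1. replace (z + RtoC 0)%C with z in H1 by ring.
  now rewrite (first_order_C_derive _ _ _ H1).
Qed.

Lemma analytic_at_derive (f : C -> C) (z : C) :
  analytic_at f z -> analytic_at (C_derive f) z.
Proof.
  rewrite !analytic_at_iff. intros [c [r [Hr H]]].
  exists (derived c), r. split; [exact Hr | ].
  apply power_sum_ext with (2 := power_sum_derive _ _ _ H).
  intros w Hw. assert (H1 := power_sum_first_order _ c r w H Hw).
  rewrite (first_order_C_derive _ _ _ H1). symmetry.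
  now apply first_order_C_derive, first_order_translate.
Qed.

(** * Means over circles *)

Lemma first_order_const (c z : C) : C_first_order (fun _ => c) z (RtoC 0).
Proof.
  intros e He. exists 1. split; [lra | ]. intros w _.
  replace (c - c - 0 * w)%C with (RtoC 0) by ring. rewrite Cmod_0.
  apply Rmult_le_pos; [lra | apply Cmod_ge_0].
Qed.

Lemma first_order_plus (f g : C -> C) (z l m : C) :
  C_first_order f z l -> C_first_order g z m ->
  C_first_order (fun w => f w + g w)%C z (l + m)%C.
Proof.
  rewrite <- !is_derive_Cring_iff. intros Hf Hg. exact (is_derive_plus (V := Cring) f g z l m Hf Hg).
Qed.

Lemma first_order_mult (f g : C -> C) (z l m : C) :
  C_first_order f z l -> C_first_order g z m ->
  C_first_order (fun w => f w * g w)%C z (l * g z + f z * m)%C.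
Proof.
  rewrite <- !is_derive_Cring_iff. intros Hf Hg.
  exact (is_derive_mult (K := C_AbsRing) f g z l m Hf Hg Cmult_comm).
Qed.

(** The remainder is exactly w^2 / (z^2 (z + w)). Keeping |w| < |z|/2 ensures |z + w| >= |z|/2, and
    the second radius makes 2 |w| / |z|^3 at most e. *)
Lemma first_order_inv (z : C) :
  z <> RtoC 0 -> C_first_order Cinv z (RtoC (-1) * (/ z * / z))%C.
Proof.
  intros Hz e He. assert (H0 := proj1 (Cmod_gt_0 z) Hz).
  set (a := Cmod z) in *.
  exists (Rmin (a / 2) (e * a ^ 3 / 2)). split.
  { apply Rmin_glb_lt; [lra | ]. assert (0 < a ^ 3) by now apply pow_lt.
    assert (0 < e * a ^ 3) by now apply Rmult_lt_0_compat. lra. }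
  intros w Hw. assert (Hw0 := Cmod_ge_0 w).
  assert (Hw1 := Rlt_le_trans _ _ _ Hw (Rmin_l _ _)).
  assert (Hw2 := Rlt_le_trans _ _ _ Hw (Rmin_r _ _)).
  assert (Hzw : a / 2 <= Cmod (z + w)%C).
  { assert (H := Cmod_triangle (z + w)%C (- w)%C). rewrite Cmod_opp in H.
    replace (z + w + - w)%C with z in H by ring. fold a in H. lra. }
  assert (Hn : (z + w)%C <> RtoC 0).
  { apply Cmod_gt_0. lra. }
  replace (/ (z + w) - / z - RtoC (-1) * (/ z * / z) * w)%C
    with (w * w * (/ z * / z * / (z + w)))%C by (field; auto).
  rewrite !Cmod_mult, !Cmod_inv by auto. fold a.
  assert (Hi : / Cmod (z + w)%C <= 2 / a).
  { replace (2 / a) with (/ (a / 2)) by (field; lra). apply Rinv_le_contravar; lra. }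
  apply Rle_trans with (Cmod w * Cmod w * (/ a * / a * (2 / a))).
  { apply Rmult_le_compat_l; [now apply Rmult_le_pos | ].
    apply Rmult_le_compat_l; [ | exact Hi].
    apply Rlt_le, Rmult_lt_0_compat; now apply Rinv_0_lt_compat. }
  replace (Cmod w * Cmod w * (/ a * / a * (2 / a)))
    with ((Cmod w * 2 / a ^ 3) * Cmod w) by (field; lra).
  apply Rmult_le_compat_r; [exact Hw0 | ].
  apply Rle_div_l; [now apply pow_lt | lra].
Qed.

(* The second derivative only serves to make the first one continuous. *)
Definition punctured_diff2 (k : C -> C) : Prop :=
  exists k1, forall w, 0 < Cmod w < 1 ->
    C_first_order k w (k1 w) /\ exists l, C_first_order k1 w l.

Lemma punctured_diff2_const (c : C) : punctured_diff2 (fun _ => c).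
Proof.
  exists (fun _ => RtoC 0). intros w _.
  split; [apply first_order_const | eexists; apply first_order_const].
Qed.

Lemma punctured_diff2_mult (f g : C -> C) :
  punctured_diff2 f -> punctured_diff2 g -> punctured_diff2 (fun w => f w * g w)%C.
Proof.
  intros [f1 Hf] [g1 Hg]. exists (fun w => f1 w * g w + f w * g1 w)%C.
  intros w Hw. destruct (Hf w Hw) as [A1 [l A2]], (Hg w Hw) as [B1 [m B2]].
  split; [now apply first_order_mult | ].
  eexists. apply first_order_plus; apply first_order_mult; eassumption.
Qed.

(** The integrands carry negative powers of the variable; this is why the origin is excluded from
    [punctured_diff2]. *)
Lemma punctured_diff2_inv : punctured_diff2 Cinv.
Proof.
  exists (fun w => RtoC (-1) * (/ w * / w))%C. intros w Hw.
  assert (w <> RtoC 0) by (apply Cmod_gt_0; lra).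
  split; [now apply first_order_inv | ].
  eexists. apply first_order_mult; [apply first_order_const | ].
  apply first_order_mult; now apply first_order_inv.
Qed.

Lemma punctured_diff2_pow (k : C -> C) (n : nat) :
  punctured_diff2 k -> punctured_diff2 (fun w => k w ^ n)%C.
Proof.
  intros H. induction n; simpl.
  - apply punctured_diff2_const.
  - now apply punctured_diff2_mult.
Qed.

Lemma punctured_diff2_id : punctured_diff2 (fun w => w).
Proof.
  exists (fun _ => RtoC 1). intros w _. split.
  - intros e He. exists 1. split; [lra | ]. intros v _.
    replace (w + v - w - 1 * v)%C with (RtoC 0) by ring. rewrite Cmod_0.
    apply Rmult_le_pos; [lra | apply Cmod_ge_0].
  - eexists. apply first_order_const.
Qed.

Lemma punctured_diff2_analytic (f : C -> C) :
  analytic_in_disc f -> punctured_diff2 f.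
Proof.
  intros H. exists (C_derive f). intros w [_ Hw]. split.
  - now apply analytic_at_first_order, H.
  - eexists. apply analytic_at_first_order, analytic_at_derive, H, Hw.
Qed.

(** * Continuity of complex maps and differentiation along plane curves *)

Lemma continuous_Cpair {U : UniformSpace} (f g : U -> R) (x : U) :
  continuous f x -> continuous g x ->
  continuous (U := C_UniformSpace) (fun u => (f u, g u)) x.
Proof.
  intros Hf Hg. apply (continuous_comp_2 f g (fun a b => (a, b) : C_UniformSpace)); auto.
  apply continuous_ext with (fun u => u); [now intros [a b] | apply continuous_id].
Qed.

Lemma continuous_Re {U : UniformSpace} (f : U -> C) (x : U) :
  continuous (U := C_UniformSpace) f x -> continuous (fun u => Re (f u)) x.
Proof.
  intros H. apply (continuous_comp (V := C_UniformSpace) f fst); [exact H | ].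
  destruct (f x). apply continuous_fst.
Qed.

Lemma continuous_Im {U : UniformSpace} (f : U -> C) (x : U) :
  continuous (U := C_UniformSpace) f x -> continuous (fun u => Im (f u)) x.
Proof.
  intros H. apply (continuous_comp (V := C_UniformSpace) f snd); [exact H | ].
  destruct (f x). apply continuous_snd.
Qed.

Lemma continuous_Rmult {U : UniformSpace} (f g : U -> R) (x : U) :
  continuous f x -> continuous g x -> continuous (fun u => f u * g u) x.
Proof. intros Hf Hg. exact (continuous_mult (K := R_AbsRing) f g x Hf Hg). Qed.

Lemma continuous_Rplus {U : UniformSpace} (f g : U -> R) (x : U) :
  continuous f x -> continuous g x -> continuous (fun u => f u + g u) x.
Proof. intros Hf Hg. exact (continuous_plus (V := R_NormedModule) f g x Hf Hg). Qed.

Lemma continuous_Rminus {U : UniformSpace} (f g : U -> R) (x : U) :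
  continuous f x -> continuous g x -> continuous (fun u => f u - g u) x.
Proof. intros Hf Hg. exact (continuous_minus (V := R_NormedModule) f g x Hf Hg). Qed.

Lemma continuous_Cmult {U : UniformSpace} (f g : U -> C) (x : U) :
  continuous (U := C_UniformSpace) f x -> continuous (U := C_UniformSpace) g x ->
  continuous (U := C_UniformSpace) (fun u => f u * g u)%C x.
Proof.
  intros Hf Hg. unfold Cmult. apply continuous_Cpair.
  - apply continuous_Rminus; apply continuous_Rmult;
      (apply continuous_Re || apply continuous_Im); assumption.
  - apply continuous_Rplus; apply continuous_Rmult;
      (apply continuous_Re || apply continuous_Im); assumption.
Qed.

Lemma first_order_bound (f : C -> C) (z l : C) :
  C_first_order f z l -> forall e, 0 < e -> exists d, 0 < d /\
    forall w, Cmod w < d -> Cmod (f (z + w) - f z)%C < e.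
Proof.
  intros H e He. destruct (H 1 Rlt_0_1) as [d [Hd H1]].
  assert (Hl := Cmod_ge_0 l).
  exists (Rmin d (e / (Cmod l + 1))). split.
  { apply Rmin_glb_lt; [lra | apply Rdiv_lt_0_compat; lra]. }
  intros w Hw.
  assert (Hw1 := Rlt_le_trans _ _ _ Hw (Rmin_l _ _)).
  assert (Hw2 := Rlt_le_trans _ _ _ Hw (Rmin_r _ _)).
  specialize (H1 w Hw1).
  replace (f (z + w) - f z)%C with ((f (z + w) - f z - l * w) + l * w)%C by ring.
  apply Rle_lt_trans with (1 := Cmod_triangle _ _). rewrite Cmod_mult.
  apply Rlt_div_r in Hw2; lra.
Qed.

Lemma first_order_continuous (f : C -> C) (z l : C) :
  C_first_order f z l ->
  continuous (T := C_UniformSpace) (U := C_UniformSpace) f z.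
Proof.
  intros H. apply filterlim_locally. intros eps.
  destruct (first_order_bound f z l H eps (cond_pos eps)) as [d [Hd H1]].
  (* Product balls are squares: half sides d/2 keep |Re| + |Im|, hence the modulus, below d. *)
  assert (Hd2 : 0 < d / 2) by lra.
  exists (mkposreal _ Hd2). intros y [Hy1 Hy2].
  assert (Hy : Cmod (y - z)%C < d).
  { apply Rle_lt_trans with (1 := Cmod_le_Re_Im _).
    change (Rabs (Re y - Re z) < d / 2) in Hy1.
    change (Rabs (Im y - Im z) < d / 2) in Hy2.
    change (Rabs (Re y - Re z) + Rabs (Im y - Im z) < d). lra. }
  specialize (H1 (y - z)%C Hy).
  assert (Ey : forall a b : C, (a + (b - a))%C = b) by (intros; ring).
  rewrite Ey in H1. split.
  - apply Rle_lt_trans with (2 := H1). apply (re_le_Cmod (f y - f z)%C).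
  - apply Rle_lt_trans with (2 := H1). apply (im_le_Cmod (f y - f z)%C).
Qed.

(** The same division-free remainder form as [C_first_order], so that the chain rule below is an
    addition of errors. *)
Lemma is_derive_R_iff (f : R -> R) (x l : R) :
  is_derive f x l <->
  forall e, 0 < e -> exists d, 0 < d /\
    forall s, Rabs s < d -> Rabs (f (x + s) - f x - l * s) <= e * Rabs s.
Proof.
  rewrite is_derive_Reals. split.
  - intros H e He. destruct (H e He) as [d Hd].
    exists d. split; [apply cond_pos | ]. intros s Hs.
    destruct (Req_dec s 0) as [-> | Hs0].
    + rewrite Rplus_0_r, Rabs_R0. replace (f x - f x - l * 0) with 0 by ring.
      rewrite Rabs_R0. lra.
    + specialize (Hd s Hs0 Hs).
      replace (f (x + s) - f x - l * s) with (((f (x + s) - f x) / s - l) * s) by (field; auto).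
      rewrite Rabs_mult. apply Rmult_le_compat_r; [apply Rabs_pos | lra].
  - intros H e He. destruct (H (e / 2) ltac:(lra)) as [d [Hd H1]].
    exists (mkposreal d Hd). intros s Hs0 Hs. specialize (H1 s Hs).
    replace ((f (x + s) - f x) / s - l) with ((f (x + s) - f x - l * s) / s) by (field; auto).
    assert (Ha := Rabs_pos_lt s Hs0).
    unfold Rdiv at 1. rewrite Rabs_mult, Rabs_inv.
    apply Rle_lt_trans with (e / 2); [ | lra].
    apply Rle_div_l; lra.
Qed.

Lemma first_order_along_curve (k : C -> C) (l : C) (a b : R -> R) (x a' b' : R) :
  is_derive a x a' -> is_derive b x b' -> C_first_order k (a x, b x) l ->
  is_derive (fun s => Re (k (a s, b s))) x (Re (l * (a', b'))%C) /\
  is_derive (fun s => Im (k (a s, b s))) x (Im (l * (a', b'))%C).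
Proof.
  intros Ha Hb Hk.
  (* Both conclusions are components of one complex first-order estimate in the real parameter. *)
  enough (H : forall e, 0 < e -> exists d, 0 < d /\ forall s, Rabs s < d ->
     Cmod (k (a (x + s)%R, b (x + s)%R) - k (a x, b x) - (l * (a', b')) * RtoC s)%C
       <= e * Rabs s).
  { split; apply is_derive_R_iff; intros e He; destruct (H e He) as [d [Hd H1]];
      exists d; split; auto; intros s Hs; apply Rle_trans with (2 := H1 s Hs);
      [ eapply Rle_trans; [ | apply re_le_Cmod] | eapply Rle_trans; [ | apply im_le_Cmod] ];
      right; generalize (k (a x, b x)) (k (a (x + s), b (x + s))); intros [p1 p2] [q1 q2];
      destruct l as [l1 l2]; unfold Re, Im, Cminus, Cplus, Copp, Cmult, RtoC;
      cbn [fst snd]; f_equal; ring. }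
  rewrite is_derive_R_iff in Ha, Hb.
  set (v := (a', b') : C) in *. set (z := (a x, b x) : C) in *.
  assert (Hv := Cmod_ge_0 v). assert (Hl := Cmod_ge_0 l).
  intros e He.
  (* [e2] is the tolerance for [k], met with an increment of size at most (|v| + 2)|s|; [e1] is the
     tolerance for each coordinate of the curve, met with a factor 2 |l|. Each contributes at most
     e/2, and e1 <= 1 is what bounds the increment. *)
  set (e2 := e / (2 * (Cmod v + 2))). assert (He2 : 0 < e2) by (apply Rdiv_lt_0_compat; lra).
  set (e1 := Rmin 1 (e / (4 * (Cmod l + 1)))).
  assert (He1 : 0 < e1) by (apply Rmin_glb_lt; [lra | apply Rdiv_lt_0_compat; lra]).
  assert (He1' : e1 <= 1) by apply Rmin_l.
  assert (He1'' : e1 * (4 * (Cmod l + 1)) <= e) by (apply Rle_div_r; [lra | apply Rmin_r]).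
  destruct (Ha e1 He1) as [d1 [Hd1 A]], (Hb e1 He1) as [d2 [Hd2 B]].
  destruct (Hk e2 He2) as [d3 [Hd3 K]].
  exists (Rmin (Rmin d1 d2) (d3 / (Cmod v + 3))). split.
  { repeat apply Rmin_glb_lt; auto. apply Rdiv_lt_0_compat; lra. }
  intros s Hs. assert (Hs0 := Rabs_pos s).
  assert (Hs1 := Rlt_le_trans _ _ _ Hs (Rmin_l _ _)).
  assert (Hs3 := Rlt_le_trans _ _ _ Hs (Rmin_r _ _)).
  assert (Hs2 := Rlt_le_trans _ _ _ Hs1 (Rmin_r _ _)).
  apply Rlt_le_trans with (2 := Rmin_l _ _) in Hs1.
  specialize (A s Hs1). specialize (B s Hs2).
  set (D := ((a (x + s)%R, b (x + s)%R) - z)%C).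
  assert (HD : Cmod (D - v * RtoC s)%C <= 2 * e1 * Rabs s).
  { apply Rle_trans with (1 := Cmod_le_Re_Im _).
    replace (Re (D - v * RtoC s)%C) with (a (x + s) - a x - a' * s) by (simpl; ring).
    replace (Im (D - v * RtoC s)%C) with (b (x + s) - b x - b' * s) by (simpl; ring).
    lra. }
  assert (HD' : Cmod D <= (Cmod v + 2) * Rabs s).
  { replace D with ((D - v * RtoC s) + v * RtoC s)%C by ring.
    apply Rle_trans with (1 := Cmod_triangle _ _). rewrite Cmod_mult, Cmod_R.
    assert (e1 * Rabs s <= 1 * Rabs s) by (apply Rmult_le_compat_r; lra). lra. }
  assert (HD3 : Cmod D < d3).
  { apply Rle_lt_trans with (1 := HD').
    apply Rlt_div_r in Hs3; [ | lra]. lra. }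
  specialize (K D HD3).
  replace (z + D)%C with ((a (x + s), b (x + s)) : C) in K
    by (unfold D; generalize ((a (x + s), b (x + s)) : C); intros y;
        change (@eq C y (z + (y - z))%C); ring).
  replace (k (a (x + s)%R, b (x + s)%R) - k z - l * v * RtoC s)%C
    with ((k (a (x + s)%R, b (x + s)%R) - k z - l * D) + l * (D - v * RtoC s))%C by ring.
  apply Rle_trans with (1 := Cmod_triangle _ _). rewrite Cmod_mult.
  apply Rle_trans with (e / 2 * Rabs s + e / 2 * Rabs s); [ | right; field].
  apply Rplus_le_compat.
  - apply Rle_trans with (1 := K). apply Rle_trans with (e2 * ((Cmod v + 2) * Rabs s)).
    + apply Rmult_le_compat_l; lra.
    + right. unfold e2. field. lra.
  - apply Rle_trans with (Cmod l * (2 * e1 * Rabs s)); [apply Rmult_le_compat_l; auto | ].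
    rewrite <- Rmult_assoc. apply Rmult_le_compat_r; [auto | ].
    assert (0 <= e1 * Cmod l) by (apply Rmult_le_pos; lra). lra.
Qed.

(** * Invariance of the circle mean under change of radius *)

Definition circle (t : R) : C := (cos t, sin t).

Lemma Cmod_circle (t : R) : Cmod (circle t) = 1.
Proof.
  unfold Cmod, circle; simpl. rewrite !Rmult_1_r.
  replace (cos t * cos t + sin t * sin t) with 1; [apply sqrt_1 | ].
  assert (H := sin2_cos2 t). unfold Rsqr in H. lra.
Qed.

Definition polar (r t : R) : C := (RtoC r * circle t)%C.

Lemma Cmod_polar (r t : R) : 0 <= r -> Cmod (polar r t) = r.
Proof. intros. unfold polar. rewrite Cmod_mult, Cmod_circle, Cmod_RtoC_pos by auto. ring. Qed.

Lemma polar_pair (r t : R) : polar r t = (r * cos t, r * sin t).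
Proof. unfold polar, circle, Cmult, RtoC; simpl. f_equal; ring. Qed.

Lemma continuous_polar2 (x t : R) :
  continuous (U := C_UniformSpace) (fun u : R * R => polar (fst u) (snd u)) (x, t).
Proof.
  apply continuous_ext with (fun u : R * R => (fst u * cos (snd u), fst u * sin (snd u)) : C).
  { intros u. now rewrite polar_pair. }
  apply continuous_Cpair; (apply continuous_Rmult; [apply continuous_fst | ]).
  - apply (continuous_comp snd cos); [apply continuous_snd | apply continuous_cos].
  - apply (continuous_comp snd sin); [apply continuous_snd | apply continuous_sin].
Qed.

Lemma continuous_polar (r t : R) :
  continuous (U := C_UniformSpace) (fun t => polar r t) t.
Proof.
  apply continuous_ext with (fun t => (r * cos t, r * sin t) : C).
  { intros u. now rewrite polar_pair. }
  apply continuous_Cpair; (apply continuous_Rmult; [apply continuous_const | ]).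
  - apply continuous_cos.
  - apply continuous_sin.
Qed.

Lemma continuous_circle (t : R) : continuous (U := C_UniformSpace) circle t.
Proof. apply continuous_Cpair; [apply continuous_cos | apply continuous_sin]. Qed.

Lemma ex_RInt_punctured (k : C -> C) (r : R) :
  punctured_diff2 k -> 0 < r < 1 -> ex_RInt (fun t => Re (k (polar r t))) 0 (2 * PI).
Proof.
  intros [k1 Hk] Hr. apply (ex_RInt_continuous (V := R_CompleteNormedModule)).
  intros t _. apply (continuous_Re (fun t => k (polar r t))).
  apply (continuous_comp (V := C_UniformSpace) (polar r) k); [apply continuous_polar | ].
  apply first_order_continuous with (k1 (polar r t)).
  apply Hk. rewrite Cmod_polar; lra.
Qed.

(** In polar form the Cauchy-Riemann equations say that r times the radial derivative of Re k is the
    angular derivative of Im k. The derivative of the mean is therefore the integral of an exact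
    derivative over a full period. *)
Lemma circle_mean_derive (k : C -> C) (r : R) :
  punctured_diff2 k -> 0 < r < 1 ->
  is_derive (fun r => RInt (fun t => Re (k (polar r t))) 0 (2 * PI)) r 0.
Proof.
  intros Hk Hr. assert (Hex := fun r => ex_RInt_punctured k r Hk).
  destruct Hk as [k1 Hk].
  assert (Hrad : forall u v, 0 < u < 1 ->
    is_derive (fun z => Re (k (polar z v))) u (Re (k1 (polar u v) * circle v)%C)).
  { intros u v Hu.
    apply is_derive_ext with (fun z => Re (k (z * cos v, z * sin v))).
    { intros z. now rewrite polar_pair. }
    apply (first_order_along_curve k (k1 (polar u v)) (fun z => z * cos v) (fun z => z * sin v)).
    - auto_derive; [trivial | ring].
    - auto_derive; [trivial | ring].
    - rewrite <- polar_pair. apply Hk. rewrite Cmod_polar; lra. }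
  assert (Hang : forall t, is_derive (fun t => Im (k (polar r t))) t
                    (r * Re (k1 (polar r t) * circle t)%C)).
  { intros t.
    apply is_derive_ext with (fun t => Im (k (r * cos t, r * sin t))).
    { intros z. now rewrite polar_pair. }
    replace (r * Re (k1 (polar r t) * circle t)%C)
      with (Im (k1 (polar r t) * ((r * - sin t)%R, (r * cos t)%R))%C) by (simpl; ring).
    apply (first_order_along_curve k (k1 (polar r t)) (fun t => r * cos t) (fun t => r * sin t)).
    - auto_derive; [trivial | ring].
    - auto_derive; [trivial | ring].
    - rewrite <- polar_pair. apply Hk. rewrite Cmod_polar; lra. }
  (* Differentiation under the integral asks for joint continuity of the radial derivative; here the
     second derivative is spent. *)
  assert (Hc1 : forall w, 0 < Cmod w < 1 ->
     continuous (T := C_UniformSpace) (U := C_UniformSpace) k1 w).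
  { intros w Hw. destruct (Hk w Hw) as [_ [l Hl]]. now apply first_order_continuous with l. }
  assert (Hloc : locally r (fun u => 0 < u < 1)).
  { apply (locally_interval _ r 0 1); simpl; [lra | lra | auto]. }
  assert (HI : RInt (fun t => Derive (fun u => Re (k (polar u t))) r) 0 (2 * PI) = 0).
  { rewrite (RInt_ext _ (fun t => scal (/ r) (r * Re (k1 (polar r t) * circle t)%C))).
    2:{ intros t _. etransitivity; [apply is_derive_unique, (Hrad r t Hr) | ].
        unfold scal; simpl; unfold mult; simpl. field. lra. }
    apply is_RInt_unique.
    replace 0 with (scal (/ r) (minus (Im (k (polar r (2 * PI)))) (Im (k (polar r 0))))) at 2.
    - apply (is_RInt_scal (V := R_NormedModule)).
      apply (is_RInt_derive (V := R_CompleteNormedModule) (fun t => Im (k (polar r t)))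
        (fun t => r * Re (k1 (polar r t) * circle t)%C)).
      + intros t _. apply Hang.
      + intros t _. apply continuous_Rmult; [apply continuous_const | ].
        apply (continuous_Re (fun t => k1 (polar r t) * circle t)%C), continuous_Cmult; [ | apply continuous_circle].
        apply (continuous_comp (V := C_UniformSpace) (polar r) k1); [apply continuous_polar | ].
        apply Hc1. rewrite Cmod_polar; lra.
    - replace (polar r (2 * PI)) with (polar r 0).
      + rewrite minus_eq_zero. apply (scal_zero_r (V := R_NormedModule)).
      + unfold polar, circle. now rewrite cos_2PI, sin_2PI, cos_0, sin_0. }
  enough (H : is_derive (fun r => RInt (fun t => Re (k (polar r t))) 0 (2 * PI)) r
    (RInt (fun t => Derive (fun u => Re (k (polar u t))) r) 0 (2 * PI))).
  { rewrite HI in H. exact H. }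
  apply (is_derive_RInt_param (fun r t => Re (k (polar r t))) 0 (2 * PI) r).
  - revert Hloc. apply filter_imp. intros u Hu t _. eexists. now apply Hrad.
  - intros t _.
    apply continuity_2d_pt_ext_loc with (fun u v => Re (k1 (polar u v) * circle v)%C).
    + destruct Hloc as [d Hd]. exists d. intros u v Hu _. symmetry.
      apply is_derive_unique, Hrad. apply Hd, Hu.
    + assert (Hc : continuous (U := C_UniformSpace)
                (fun u : R * R => k1 (polar (fst u) (snd u)) * circle (snd u))%C (r, t)).
      { apply continuous_Cmult.
        - apply (continuous_comp (V := C_UniformSpace) (fun u : R * R => polar (fst u) (snd u)) k1).
          + apply continuous_polar2.
          + apply Hc1. cbn [fst snd]. rewrite Cmod_polar; lra.
        - apply (continuous_comp snd circle); [apply continuous_snd | apply continuous_circle]. }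
      apply continuous_Re in Hc. apply continuity_2d_pt_filterlim. exact Hc.
  - revert Hloc. apply filter_imp. intros u Hu. now apply Hex.
Qed.

Lemma circle_mean_constant (k : C -> C) (r s : R) :
  punctured_diff2 k -> 0 < r < 1 -> 0 < s < 1 ->
  RInt (fun t => Re (k (polar r t))) 0 (2 * PI) =
  RInt (fun t => Re (k (polar s t))) 0 (2 * PI).
Proof.
  intros Hk.
  assert (H : forall r s, 0 < r < 1 -> 0 < s < 1 -> r < s ->
    RInt (fun t => Re (k (polar r t))) 0 (2 * PI) =
    RInt (fun t => Re (k (polar s t))) 0 (2 * PI)).
  { intros a b Ha Hb Hab.
    apply (eq_is_derive (V := R_NormedModule) (fun r => RInt (fun t => Re (k (polar r t))) 0 (2 * PI))); auto.
    intros t Ht. apply circle_mean_derive; auto. lra. }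
  intros Hr Hs. destruct (Rtotal_order r s) as [h | [-> | h]]; auto.
  symmetry. auto.
Qed.

(** * The kernel of a function with real part above one half *)

Lemma circle_pow (t : R) (n : nat) : (circle t ^ n)%C = circle (INR n * t).
Proof.
  induction n.
  - simpl. unfold circle. now rewrite Rmult_0_l, cos_0, sin_0.
  - rewrite Cpow_S, IHn, S_INR. unfold circle, Cmult; simpl.
    replace ((INR n + 1) * t) with (t + INR n * t) by ring.
    rewrite cos_plus, sin_plus. f_equal; ring.
Qed.

Lemma Cconj_circle_inv (t : R) : Cconj (circle t) = (/ circle t)%C.
Proof.
  assert (H : circle t <> RtoC 0) by (apply Cmod_gt_0; rewrite Cmod_circle; lra).
  assert (E := Cmod2_conj (circle t)). rewrite Cmod_circle in E.
  replace (RtoC (1 ^ 2)) with (RtoC 1) in E by (f_equal; ring).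
  replace (Cconj (circle t)) with (/ circle t * (circle t * Cconj (circle t)))%C by (field; auto).
  rewrite <- E. ring.
Qed.

Lemma is_RInt_circle_pow (d : C) (n : nat) :
  (0 < n)%nat -> is_RInt (fun t => Re (d * circle t ^ n)%C) 0 (2 * PI) 0.
Proof.
  intros Hn. assert (Hn' : INR n <> 0) by (apply not_0_INR; lia).
  set (F := fun t => / INR n * (Re d * sin (INR n * t) + Im d * cos (INR n * t))).
  assert (E : minus (F (2 * PI)) (F 0) = 0).
  { unfold F. replace (INR n * (2 * PI)) with (0 + 2 * INR n * PI) by ring.
    rewrite cos_period, sin_period, Rmult_0_r. apply (minus_eq_zero (G := R_AbelianGroup)). }
  rewrite <- E at 2.
  apply is_RInt_ext with (fun t => Re d * cos (INR n * t) - Im d * sin (INR n * t)).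
  { intros t _. rewrite circle_pow. reflexivity. }
  apply (is_RInt_derive (V := R_CompleteNormedModule) F).
  - intros t _. unfold F. auto_derive; [trivial | field; auto].
  - intros t _. apply (ex_derive_continuous (V := R_NormedModule)). auto_derive. trivial.
Qed.

Lemma is_RInt_const_2PI (a : R) : is_RInt (fun _ => a) 0 (2 * PI) (2 * PI * a).
Proof.
  replace (2 * PI * a) with (scal (2 * PI - 0) a).
  - apply (is_RInt_const (V := R_NormedModule)).
  - unfold scal; simpl; unfold mult; simpl. ring.
Qed.

Lemma is_RInt_Rplus (f g : R -> R) (a b u v : R) :
  is_RInt f a b u -> is_RInt g a b v -> is_RInt (fun t => f t + g t) a b (u + v).
Proof. intros Hf Hg. exact (is_RInt_plus (V := R_NormedModule) f g a b u v Hf Hg). Qed.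

Lemma is_RInt_Rminus (f g : R -> R) (a b u v : R) :
  is_RInt f a b u -> is_RInt g a b v -> is_RInt (fun t => f t - g t) a b (u - v).
Proof. intros Hf Hg. exact (is_RInt_minus (V := R_NormedModule) f g a b u v Hf Hg). Qed.

Lemma polar_neq_0 (s t : R) : 0 < s -> polar s t <> RtoC 0.
Proof. intros Hs. apply Cmod_gt_0. rewrite Cmod_polar; lra. Qed.

Lemma Cinv_polar (s t : R) : 0 < s -> (/ polar s t)%C = (RtoC (/ s) * Cconj (circle t))%C.
Proof.
  intros Hs. rewrite Cconj_circle_inv, RtoC_inv by lra. unfold polar.
  assert (circle t <> RtoC 0) by (apply Cmod_gt_0; rewrite Cmod_circle; lra).
  assert (RtoC s <> RtoC 0) by (intros E; injection E; lra).
  field; auto.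
Qed.

Lemma Re_conj (z : C) : Re (Cconj z) = Re z.
Proof. reflexivity. Qed.

Lemma Re_minus (x y : C) : Re (x - y)%C = Re x - Re y.
Proof. reflexivity. Qed.

Lemma Cpow_mult_inv (w : C) (k j : nat) :
  w <> RtoC 0 -> (w ^ k * (/ w) ^ (k + j) = (/ w) ^ j)%C.
Proof.
  intros Hw. rewrite Cpow_add_r, Cpow_inv by auto.
  assert (H := Cpow_nz w k Hw). field; auto.
Qed.

(** The net power of the variable is negative. Conjugation leaves the real part unchanged and turns
    it into a positive power of [circle t], whose integral is zero. *)
Lemma is_RInt_laurent_term (s : R) (d : C) (k m : nat) :
  0 < s -> (k < m)%nat ->
  is_RInt (fun t => Re (d * polar s t ^ k * (/ polar s t) ^ m)%C) 0 (2 * PI) 0.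
Proof.
  intros Hs Hk.
  apply is_RInt_ext with (fun t => Re (Cconj (d * RtoC (/ s) ^ (m - k)) * circle t ^ (m - k))%C).
  - intros t _. rewrite <- Re_conj, Cmult_conj, Cconj_conj, Cpow_conj.
    assert (E := Cpow_mult_inv (polar s t) k (m - k) (polar_neq_0 s t Hs)).
    replace (k + (m - k))%nat with m in E by lia.
    rewrite <- (Cmult_assoc d (_ ^ k)%C), E, Cinv_polar, Cpow_mult_l by exact Hs. f_equal. ring.
  - apply is_RInt_circle_pow. lia.
Qed.

Lemma is_RInt_laurent_sum (s : R) (c : nat -> C) (d : C) (m : nat) :
  0 < s ->
  is_RInt (fun t => Re (d * Csum (fun k => c k * polar s t ^ k) (S m) * (/ polar s t) ^ m)%C)
    0 (2 * PI) (2 * PI * Re (d * c m)%C).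
Proof.
  intros Hs.
  assert (H : forall K, (K <= m)%nat ->
    is_RInt (fun t => Re (d * Csum (fun k => c k * polar s t ^ k) K * (/ polar s t) ^ m)%C)
      0 (2 * PI) 0).
  { induction K; intros HK; simpl Csum.
    - apply is_RInt_ext with (fun _ => 0).
      + intros t _. replace (d * 0 * (/ polar s t) ^ m)%C with (RtoC 0) by ring. reflexivity.
      + rewrite <- (Rmult_0_r (2 * PI)) at 2. apply is_RInt_const_2PI.
    - replace 0 with (0 + 0) at 2 by ring.
      apply is_RInt_ext with (fun t =>
        Re (d * Csum (fun k => c k * polar s t ^ k) K * (/ polar s t) ^ m)%C
        + Re (d * c K * polar s t ^ K * (/ polar s t) ^ m)%C).
      + intros t _. rewrite <- re_plus. f_equal. ring.
      + apply is_RInt_Rplus; [apply IHK; lia | now apply is_RInt_laurent_term]. }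
  rewrite <- (Rplus_0_l (2 * PI * _)). simpl Csum.
  apply is_RInt_ext with (fun t =>
    Re (d * Csum (fun k => c k * polar s t ^ k) m * (/ polar s t) ^ m)%C + Re (d * c m)%C).
  - intros t _. rewrite <- re_plus. f_equal.
    assert (E := Cpow_mult_inv (polar s t) m 0 (polar_neq_0 s t Hs)).
    rewrite Nat.add_0_r in E. simpl (_ ^ 0)%C in E.
    replace (d * c m)%C with (d * c m * (polar s t ^ m * (/ polar s t) ^ m))%C by (rewrite E; ring).
    ring.
  - apply is_RInt_Rplus; [now apply H | apply is_RInt_const_2PI].
Qed.

(** Cauchy's coefficient formula on every circle inside the disc, from information near the origin
    only. The mean may be computed on a circle of tiny radius s, where the polynomial gives the
    coefficient exactly and the remainder, divided by s^m, is at most B s. The free factor [d] lets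
    real parts detect a complex coefficient. *)
Lemma is_RInt_coefficient (psi : C -> C) (c : nat -> C) (d : C) (m : nat) (eta B r : R) :
  punctured_diff2 psi -> 0 < eta -> 0 <= B -> 0 < r < 1 ->
  (forall w, Cmod w < eta ->
     Cmod (psi w - Csum (fun k => c k * w ^ k) (S m))%C <= B * Cmod w ^ S m) ->
  is_RInt (fun t => Re (d * psi (polar r t) * (/ polar r t) ^ m)%C) 0 (2 * PI)
    (2 * PI * Re (d * c m)%C).
Proof.
  intros Hpsi Heta HB Hr Hb.
  set (k := fun w => (d * psi w * (/ w) ^ m)%C).
  assert (Hk : punctured_diff2 k).
  { repeat apply punctured_diff2_mult; [apply punctured_diff2_const | exact Hpsi | ].
    apply punctured_diff2_pow, punctured_diff2_inv. }
  assert (HI := fun s Hs => RInt_correct _ _ _ (ex_RInt_punctured k s Hk Hs)).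
  set (I := RInt (fun t => Re (k (polar r t))) 0 (2 * PI)) in *.
  assert (HPI := PI_RGT_0). assert (Hd := Cmod_ge_0 d).
  assert (Hs : forall s, 0 < s < 1 -> s < eta ->
    Rabs (I - 2 * PI * Re (d * c m)%C) <= s * (2 * PI * (Cmod d * B))).
  { intros s Hs Hse. unfold I. rewrite (circle_mean_constant k r s Hk Hr Hs).
    assert (HD := is_RInt_Rminus _ _ _ _ _ _ (HI s Hs) (is_RInt_laurent_sum s c d m (proj1 Hs))).
    rewrite <- (is_RInt_unique _ _ _ _ HD).
    replace (s * (2 * PI * (Cmod d * B))) with ((2 * PI - 0) * (Cmod d * B * s)) by ring.
    apply abs_RInt_le_const; [lra | eexists; exact HD | ].
    intros t _. rewrite <- Re_minus. apply Rle_trans with (1 := re_le_Cmod _).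
    unfold k. set (w := polar s t).
    replace (d * psi w * (/ w) ^ m - d * Csum (fun k => c k * w ^ k) (S m) * (/ w) ^ m)%C
      with (d * ((psi w - Csum (fun k => c k * w ^ k) (S m)) * (/ w) ^ m))%C by ring.
    assert (Hw : Cmod w = s) by (apply Cmod_polar; lra).
    rewrite !Cmod_mult, Cmod_pow, Cmod_inv, Hw, pow_inv by (apply polar_neq_0; lra).
    rewrite Rmult_assoc. apply Rmult_le_compat_l; [exact Hd | ].
    assert (Hp : 0 < s ^ m) by (apply pow_lt; lra).
    replace (B * s) with (B * s ^ S m * / s ^ m) by (simpl; field; lra).
    apply Rmult_le_compat_r; [now apply Rlt_le, Rinv_0_lt_compat | ].
    rewrite <- Hw. apply Hb. lra. }
  replace (2 * PI * Re (d * c m)%C) with I.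
  { apply HI, Hr. }
  apply Rminus_diag_uniq, Rabs_eq_0, Rle_antisym; [ | apply Rabs_pos].
  assert (HK : 0 <= 2 * PI * (Cmod d * B)) by (apply Rmult_le_pos; [lra | now apply Rmult_le_pos]).
  apply Rle_of_eps with (1 := HK). intros e He. rewrite Rplus_0_l.
  (* Below 1 for mean invariance, below [eta] for the remainder bound, at most [e] for the error. *)
  set (s := Rmin (e / 1) (Rmin (1 / 2) (eta / 2))).
  assert (0 < s) by (repeat apply Rmin_glb_lt; lra).
  assert (s <= e / 1) by apply Rmin_l.
  assert (s <= Rmin (1 / 2) (eta / 2)) by apply Rmin_r.
  assert (Rmin (1 / 2) (eta / 2) <= 1 / 2) by apply Rmin_l.
  assert (Rmin (1 / 2) (eta / 2) <= eta / 2) by apply Rmin_r.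
  apply Rle_trans with (1 := Hs s ltac:(lra) ltac:(lra)).
  apply Rmult_le_compat_r; lra.
Qed.

(** Puts local analyticity in the form that the coefficient formula consumes. *)
Lemma analytic_taylor_bound (f : C -> C) (K : nat) :
  analytic_at f (RtoC 0) ->
  exists eta B, 0 < eta /\ 0 <= B /\ forall w, Cmod w < eta ->
    Cmod (f w - Csum (fun k => taylor_coeff f k * w ^ k) K)%C <= B * Cmod w ^ K.
Proof.
  intros H. apply analytic_at_iff in H. destruct H as [c [r [Hr H]]].
  assert (H' : power_sum f c r).
  { apply power_sum_ext with (2 := H). intros z _. f_equal. ring. }
  (* Recentring at 0 yields another expansion of [f] at the origin, and Taylor coefficients are
     determined by any such expansion. *)
  assert (Hc : forall k, shifted c (RtoC 0) k = taylor_coeff f k).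
  { intros k. symmetry. apply (power_sum_taylor f _ (r - Cmod (RtoC 0))).
    - rewrite Cmod_0. lra.
    - apply power_sum_ext with (f := fun w => f (RtoC 0 + w)%C).
      + intros z _. f_equal. ring.
      + apply power_sum_recenter; [exact H' | now rewrite Cmod_0]. }
  destruct (power_sum_taylor_bound f c r (RtoC 0) (r / 2) H' ltac:(lra)
              ltac:(rewrite Cmod_0; lra)) as [B [HB Hb]].
  exists (r / 2), (B / (r / 2) ^ K).
  assert (Hp : 0 < (r / 2) ^ K) by (apply pow_lt; lra).
  split; [lra | split; [apply Rle_div_r; lra | ]].
  intros w Hw. assert (Hw0 := Cmod_ge_0 w).
  specialize (Hb (Cmod w / (r / 2)) w K
    ltac:(split; [apply Rle_div_r | apply Rlt_le, Rlt_div_l]; lra) ltac:(right; field; lra)).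
  replace (0 + w)%C with w in Hb by ring.
  rewrite (Csum_ext _ (fun k => taylor_coeff f k * w ^ k)%C) in Hb by (intros; now rewrite Hc).
  apply Rle_trans with (1 := Hb). right.
  unfold Rdiv at 1. rewrite Rpow_mult_distr, pow_inv. field. lra.
Qed.

(** For phi(z) = z/(1 - z) this is the Poisson kernel. The -1 corrects the constant term, which
    taking twice the real part counts double. *)
Definition kernel (phi : C -> C) (rho t : R) : R :=
  2 * Re (phi (polar rho t) * / polar rho t)%C - 1.

Lemma taylor_coeff_0 (f : C -> C) : taylor_coeff f 0 = f (RtoC 0).
Proof. unfold taylor_coeff. simpl. field. Qed.

Lemma taylor_coeff_1 (f : C -> C) : taylor_coeff f 1 = C_derive f (RtoC 0).
Proof. unfold taylor_coeff. simpl. field. Qed.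

(** With a the exponential term and b = phi(w)/w, Re a (2 Re b - 1) = Re (a b) + (Re (conj a b) - Re
    a): the first part produces the coefficient, the second integrates to zero. *)
Lemma is_RInt_kernel_term (phi : C -> C) (rho : R) (q : C) (n : nat) :
  class_A phi -> 0 < rho < 1 ->
  is_RInt (fun t => Re (q * Cconj (circle t) ^ n)%C * kernel phi rho t) 0 (2 * PI)
    (2 * PI * Re (q * (taylor_coeff phi (S n) * RtoC rho ^ n))%C).
Proof.
  intros [Ha [H0 H1]] Hrho.
  assert (Ha0 : analytic_at phi (RtoC 0)) by (apply Ha; unfold unit_disc; rewrite Cmod_0; lra).
  assert (Hd := punctured_diff2_analytic phi Ha).
  (* On |w| = rho, the conjugate of [circle t] is rho/w; together with the division of phi by w this
     gives w^(-(n+1)), hence the coefficient of index n + 1. *)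
  assert (HA : is_RInt (fun t => Re (q * RtoC rho ^ n * phi (polar rho t) * (/ polar rho t) ^ S n)%C)
                 0 (2 * PI) (2 * PI * Re (q * RtoC rho ^ n * taylor_coeff phi (S n))%C)).
  { destruct (analytic_taylor_bound phi (S (S n)) Ha0) as [eta [B [Heta [HB Hb]]]].
    now apply is_RInt_coefficient with eta B. }
  (* For n = 0 both terms integrate to 2 pi Re q, for n > 0 both to 0. *)
  assert (HC : is_RInt (fun t => Re (Cconj q * circle t ^ n * (phi (polar rho t) * / polar rho t))%C
                                 - Re (q * Cconj (circle t) ^ n)%C) 0 (2 * PI) 0).
  { destruct n as [|n].
    - destruct (analytic_taylor_bound phi 2 Ha0) as [eta [B [Heta [HB Hb]]]].
      assert (HI := is_RInt_coefficient phi (taylor_coeff phi) (Cconj q) 1 eta B rho Hd Heta HB Hrho Hb).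
      rewrite taylor_coeff_1, H1 in HI.
      assert (HD := is_RInt_Rminus _ _ _ _ _ _ HI (is_RInt_const_2PI (Re q))).
      replace (2 * PI * Re (Cconj q * 1)%C - 2 * PI * Re q) with 0 in HD
        by (unfold Re, Cmult, Cconj, RtoC; simpl; ring).
      apply is_RInt_ext with (2 := HD). intros t _. f_equal; simpl (_ ^ _)%C;
        [f_equal; ring | f_equal; f_equal; ring].
    - destruct (analytic_taylor_bound phi 1 Ha0) as [eta [B [Heta [HB Hb]]]].
      (* For a positive frequency no negative power is left: phi(w) w^n is analytic and vanishes at
         0, so the formula applies with m = 0 and zero coefficients. The radius [Rmin eta 1] keeps
         |w|^n at most 1. *)
      assert (HI : is_RInt (fun t => Re (Cconj q * RtoC (/ rho) ^ S n * (phi (polar rho t) * polar rho t ^ n)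
                                         * (/ polar rho t) ^ 0)%C) 0 (2 * PI)
                     (2 * PI * Re (Cconj q * RtoC (/ rho) ^ S n * RtoC 0)%C)).
      { apply (is_RInt_coefficient (fun w => phi w * w ^ n)%C (fun _ => RtoC 0)) with (Rmin eta 1) B; auto.
        - apply punctured_diff2_mult; [exact Hd | ].
          apply punctured_diff2_pow, punctured_diff2_id.
        - apply Rmin_glb_lt; lra.
        - intros w Hw.
          assert (Hw1 := Rlt_le_trans _ _ _ Hw (Rmin_l _ _)).
          assert (Hw2 := Rlt_le_trans _ _ _ Hw (Rmin_r _ _)).
          specialize (Hb w Hw1). simpl in Hb. rewrite taylor_coeff_0, H0 in Hb.
          replace (phi w - (0 + 0 * 1))%C with (phi w) in Hb by ring.
          simpl Csum. replace (phi w * w ^ n - (0 + 0 * 1))%C with (phi w * w ^ n)%C by ring.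
          rewrite Cmod_mult, Cmod_pow. simpl (_ ^ 1).
          assert (Hp : Cmod w ^ n <= 1).
          { rewrite <- (pow1 n). apply pow_incr. split; [apply Cmod_ge_0 | lra]. }
          assert (Hp0 := pow_le _ n (Cmod_ge_0 w)).
          rewrite <- (Rmult_1_r (B * _)).
          apply Rmult_le_compat; auto using Cmod_ge_0. }
      assert (HJ := is_RInt_circle_pow (Cconj q) (S n) (Nat.lt_0_succ n)).
      assert (HD := is_RInt_Rminus _ _ _ _ _ _ HI HJ).
      replace (2 * PI * Re (Cconj q * RtoC (/ rho) ^ S n * 0)%C - 0) with 0 in HD
        by (replace (Cconj q * RtoC (/ rho) ^ S n * 0)%C with (RtoC 0) by ring; simpl; ring).
      apply is_RInt_ext with (2 := HD). intros t _. f_equal.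
      + f_equal. assert (Hp := polar_neq_0 rho t (proj1 Hrho)).
        replace (circle t) with (RtoC (/ rho) * polar rho t)%C.
        * rewrite Cpow_mult_l, !Cpow_S. simpl (_ ^ 0)%C. field; auto.
        * unfold polar. rewrite RtoC_inv by lra. field.
          intros E; injection E; lra.
      + rewrite <- (Re_conj (Cconj q * _)%C), Cmult_conj, Cconj_conj, Cpow_conj. reflexivity. }
  assert (HS := is_RInt_Rplus _ _ _ _ _ _ HA HC).
  replace (q * (taylor_coeff phi (S n) * RtoC rho ^ n))%C
    with (q * RtoC rho ^ n * taylor_coeff phi (S n))%C by ring.
  rewrite Rplus_0_r in HS.
  apply is_RInt_ext with (2 := HS). intros t _.
  assert (E : Cconj (circle t) = (RtoC rho * / polar rho t)%C).
  { rewrite Cinv_polar, RtoC_inv by lra. field. intros E; injection E; lra. }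
  unfold kernel. set (b := (phi (polar rho t) * / polar rho t)%C).
  set (a := (q * Cconj (circle t) ^ n)%C).
  replace (q * RtoC rho ^ n * phi (polar rho t) * (/ polar rho t) ^ S n)%C with (a * b)%C.
  2:{ unfold a, b. rewrite E, Cpow_mult_l, Cpow_S. ring. }
  replace (Cconj q * circle t ^ n)%C with (Cconj a).
  2:{ unfold a. now rewrite Cmult_conj, Cpow_conj, Cconj_conj. }
  destruct a as [a1 a2], b as [b1 b2]. simpl. ring.
Qed.

Lemma kernel_pos (phi : C -> C) (rho t : R) :
  (forall z, unit_disc z -> Re (div_by_id phi z) > 1 / 2) ->
  0 < rho < 1 -> 0 < kernel phi rho t.
Proof.
  intros H Hrho. assert (Hp := polar_neq_0 rho t (proj1 Hrho)).
  specialize (H (polar rho t)). unfold unit_disc in H. rewrite Cmod_polar in H by lra.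
  specialize (H (proj2 Hrho)). unfold div_by_id in H.
  destruct (Ceq_dec (polar rho t) 0) as [E | _]; [contradiction | ].
  unfold kernel. unfold Cdiv in H. lra.
Qed.

(** A lower bound for a trigonometric polynomial survives averaging against a positive kernel of
    mean 1. *)
Lemma kernel_average_bound (phi : C -> C) (rho delta : R) (q : nat -> C) (N : nat) :
  class_A phi -> (forall z, unit_disc z -> Re (div_by_id phi z) > 1 / 2) ->
  0 < rho < 1 ->
  (forall t, 0 <= t <= 2 * PI -> delta <= Re (Csum (fun n => q n * Cconj (circle t) ^ n)%C N)) ->
  delta <= Re (Csum (fun n => q n * (taylor_coeff phi (S n) * RtoC rho ^ n))%C N).
Proof.
  intros HA Hphi Hrho H. assert (HPI := PI_RGT_0).
  assert (HI : is_RInt (fun t => Re (Csum (fun n => q n * Cconj (circle t) ^ n)%C N) * kernel phi rho t)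
    0 (2 * PI) (2 * PI * Re (Csum (fun n => q n * (taylor_coeff phi (S n) * RtoC rho ^ n))%C N))).
  { clear H. induction N.
    - simpl. apply is_RInt_ext with (fun _ => 0).
      + intros t _. symmetry. apply Rmult_0_l.
      + apply is_RInt_const_2PI.
    - assert (HS := is_RInt_Rplus _ _ _ _ _ _ IHN (is_RInt_kernel_term phi rho (q N) N HA Hrho)).
      rewrite <- Rmult_plus_distr_l, <- re_plus in HS.
      apply is_RInt_ext with (2 := HS). intros t _.
      rewrite <- Rmult_plus_distr_r, <- re_plus. reflexivity. }
  (* The constant term n = 0 with q = delta supplies the total mass of the kernel, where phi'(0) = 1
     is used. *)
  assert (HW := is_RInt_kernel_term phi rho (RtoC delta) 0 HA Hrho).
  rewrite taylor_coeff_1, (proj2 (proj2 HA)) in HW.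
  apply Rmult_le_reg_l with (2 * PI); [lra | ].
  replace (2 * PI * delta) with (2 * PI * Re (RtoC delta * (1 * RtoC rho ^ 0))%C)
    by (simpl; ring).
  apply (is_RInt_le _ _ 0 (2 * PI) _ _ ltac:(lra) HW HI).
  intros t Ht. apply Rmult_le_compat_r; [now apply Rlt_le, kernel_pos | ].
  replace (Re (RtoC delta * Cconj (circle t) ^ 0)%C) with delta by (simpl; ring).
  apply H. lra.
Qed.

(* Carathéodory's bound, from [kernel_average_bound] applied to a monomial. *)
Lemma taylor_coeff_bound (phi : C -> C) (rho : R) (n : nat) :
  class_A phi -> (forall z, unit_disc z -> Re (div_by_id phi z) > 1 / 2) ->
  0 < rho < 1 -> Cmod (taylor_coeff phi (S n)) * rho ^ n <= 1.
Proof.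
  intros HA Hphi Hrho.
  set (x := (taylor_coeff phi (S n) * RtoC rho ^ n)%C).
  replace (Cmod (taylor_coeff phi (S n)) * rho ^ n) with (Cmod x).
  2:{ unfold x. rewrite Cmod_mult, Cmod_pow, Cmod_RtoC_pos; lra. }
  destruct (Cmod_rotate x) as [e [He Hx]].
  assert (Hsum : forall u, Csum (fun k => (if Nat.eq_dec k n then - e else RtoC 0) * u k)%C (S n)
                           = (- e * u n)%C).
  { intros u. simpl. rewrite (Csum_ext _ (fun k => RtoC 0 * u k)%C).
    - rewrite Csum_scal. destruct (Nat.eq_dec n n); [ring | contradiction].
    - intros k Hk. destruct (Nat.eq_dec k n); [lia | reflexivity]. }
  (* The monomial -e conj([circle t])^n has modulus 1, hence real part at least -1; the choice of e
     makes its average equal to -|x|. *)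
  assert (H := kernel_average_bound phi rho (-1)
    (fun k => if Nat.eq_dec k n then - e else RtoC 0)%C (S n) HA Hphi Hrho).
  rewrite Hsum in H. fold x in H.
  replace (- e * x)%C with (- RtoC (Cmod x))%C in H by (rewrite <- Hx; ring).
  change (Re (- RtoC (Cmod x))%C) with (- Cmod x) in H.
  enough (-1 <= - Cmod x) by lra. apply H.
  intros t _. rewrite (Hsum (fun k => Cconj (circle t) ^ k)%C).
  assert (Hm : Cmod (- e * Cconj (circle t) ^ n)%C = 1).
  { rewrite Cmod_mult, Cmod_opp, Cmod_pow, Cmod_conj, Cmod_circle, He, pow1. ring. }
  assert (Hr := re_le_Cmod (- e * Cconj (circle t) ^ n)%C). rewrite Hm in Hr.
  apply Rabs_le_between in Hr. lra.
Qed.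

(** * Convolution *)

(** The remainder bound at the origin with the fixed ratio q = r/t < 1 is uniform on the closed disc
    of radius r. *)
Lemma power_sum_uniform (f : C -> C) (c : nat -> C) (R0 r e : R) :
  power_sum f c R0 -> 0 <= r < R0 -> 0 < e ->
  exists N, forall n w, (N <= n)%nat -> Cmod w <= r ->
    Cmod (f w - Csum (fun k => c k * w ^ k) n)%C <= e.
Proof.
  intros Hf Hr He. set (t := (r + R0) / 2).
  assert (Ht : r < t < R0) by (unfold t; lra).
  destruct (power_sum_taylor_bound f c R0 (RtoC 0) t Hf ltac:(lra)
              ltac:(rewrite Cmod_0; lra)) as [B [HB Hb]].
  assert (Hc : forall k, shifted c (RtoC 0) k = c k).
  { intros k. rewrite <- (power_sum_taylor f c R0 k ltac:(lra) Hf). symmetry.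
    apply (power_sum_taylor f _ (R0 - Cmod (RtoC 0))).
    - rewrite Cmod_0. lra.
    - apply power_sum_ext with (f := fun w => f (RtoC 0 + w)%C).
      + intros z _. f_equal. ring.
      + apply power_sum_recenter; [exact Hf | rewrite Cmod_0; lra]. }
  assert (Hq : 0 <= r / t < 1) by (split; [apply Rle_div_r | apply Rlt_div_l]; lra).
  destruct (pow_lt_1_zero (r / t) ltac:(rewrite Rabs_pos_eq; lra) (e / (B + 1))) as [N HN].
  { apply Rdiv_lt_0_compat; lra. }
  exists N. intros n w Hn Hw.
  specialize (Hb (r / t) w n ltac:(lra) ltac:(apply Rle_trans with (1 := Hw); right; field; lra)).
  replace (0 + w)%C with w in Hb by ring.
  rewrite (Csum_ext _ (fun k => c k * w ^ k)%C) in Hb by (intros; now rewrite Hc).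
  apply Rle_trans with (1 := Hb).
  specialize (HN n Hn). assert (Hp := pow_le _ n (proj1 Hq)).
  rewrite Rabs_pos_eq in HN by auto.
  apply (Rmult_lt_compat_r (B + 1)) in HN; [ | lra].
  replace (e / (B + 1) * (B + 1)) with e in HN by (field; lra).
  assert ((r / t) ^ n * B <= (r / t) ^ n * (B + 1)) by (apply Rmult_le_compat_l; lra). lra.
Qed.

Lemma continuous_Cmod {U : UniformSpace} (f : U -> C) (x : U) :
  continuous (U := C_UniformSpace) f x -> continuous (fun u => Cmod (f u)) x.
Proof.
  intros H. apply (continuous_comp (V := C_UniformSpace) f Cmod); [exact H | ].
  apply (filterlim_norm (K := C_AbsRing) (V := C_NormedModule)).
Qed.

(** Compactness of the parameter interval turns the strict pointwise inequality into a uniform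
    margin, able to absorb truncation errors. *)
Lemma circle_margin (F G : C -> C) (cF cG : nat -> C) (u : C) :
  power_sum F cF 1 -> power_sum G cG 1 -> Cmod u < 1 ->
  (forall z, Cmod z < 1 -> Cmod (G z) < Re (F z)) ->
  exists delta, 0 < delta /\ forall t, 0 <= t <= 2 * PI ->
    delta <= Re (F (u * Cconj (circle t)))%C - Cmod (G (u * Cconj (circle t)))%C.
Proof.
  intros HF HG Hu H.
  assert (Hm : forall t, Cmod (u * Cconj (circle t))%C < 1).
  { intros t. rewrite Cmod_mult, Cmod_conj, Cmod_circle. lra. }
  assert (Hcirc : forall t, continuous (U := C_UniformSpace) (fun t => u * Cconj (circle t))%C t).
  { intros t. apply continuous_Cmult; [apply continuous_const | ].
    apply (continuous_Cpair cos (fun t => - sin t)); [apply continuous_cos | ].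
    apply (continuous_opp (V := R_NormedModule) sin), continuous_sin. }
  assert (Hcomp : forall f c t, power_sum f c 1 ->
    continuous (U := C_UniformSpace) (fun t => f (u * Cconj (circle t)))%C t).
  { intros f c t Hf.
    apply (continuous_comp (V := C_UniformSpace) (fun t => u * Cconj (circle t))%C f); [apply Hcirc | ].
    eapply first_order_continuous, power_sum_first_order; [exact Hf | apply Hm]. }
  destruct (continuity_ab_min
    (fun t => Re (F (u * Cconj (circle t)))%C - Cmod (G (u * Cconj (circle t)))%C) 0 (2 * PI))
    as [m [Hmin _]].
  - assert (HPI := PI_RGT_0). lra.
  - intros t _. apply continuity_pt_filterlim.
    apply (continuous_Rminus (fun t => Re (F (u * Cconj (circle t)))%C)
             (fun t => Cmod (G (u * Cconj (circle t)))%C)).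
    + apply (continuous_Re (fun t => F (u * Cconj (circle t)))%C), Hcomp with cF, HF.
    + apply (continuous_Cmod (fun t => G (u * Cconj (circle t)))%C), Hcomp with cG, HG.
  - eexists. split; [ | exact Hmin]. specialize (H _ (Hm m)). simpl. lra.
Qed.

Lemma Csum_plus (u v : nat -> C) (n : nat) :
  Csum (fun k => u k + v k)%C n = (Csum u n + Csum v n)%C.
Proof. induction n; simpl; [ring | rewrite IHn; ring]. Qed.

(** For unimodular e the lower bound Re (F + e G) >= Re F - |G| concerns an expression linear in F
    and G, so it passes through the average; a suitable e then recovers |G1 z|. *)
Lemma convolution_dominates (phi F G F1 G1 : C -> C) (cF cG : nat -> C) :
  class_A phi -> (forall z, unit_disc z -> Re (div_by_id phi z) > 1 / 2) ->
  power_sum F cF 1 -> power_sum G cG 1 ->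
  power_sum F1 (fun n => cF n * taylor_coeff phi (S n))%C 1 ->
  power_sum G1 (fun n => cG n * taylor_coeff phi (S n))%C 1 ->
  (forall z, Cmod z < 1 -> Cmod (G z) < Re (F z)) ->
  forall z, Cmod z < 1 -> Cmod (G1 z) < Re (F1 z).
Proof.
  intros HA Hphi HF HG HF1 HG1 H z Hz. assert (Hz0 := Cmod_ge_0 z).
  (* Any rho strictly between |z| and 1 would do: z splits as u rho, where rho is the radius of the
     kernel and |u| < 1 that of the circle on which F and G are sampled. *)
  set (rho := (1 + Cmod z) / 2). assert (Hrho : Cmod z < rho < 1) by (unfold rho; lra).
  assert (Hrho0 : RtoC rho <> RtoC 0) by (intros E; injection E; lra).
  set (u := (z * RtoC (/ rho))%C).
  assert (Hzu : z = (u * RtoC rho)%C) by (unfold u; rewrite RtoC_inv by lra; field; auto).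
  assert (Hu : Cmod u < 1).
  { unfold u. rewrite Cmod_mult, Cmod_RtoC_pos by (apply Rlt_le, Rinv_0_lt_compat; lra).
    apply Rlt_div_l; lra. }
  destruct (circle_margin F G cF cG u HF HG Hu H) as [delta [Hd Hmargin]].
  (* The sign makes Re (F1 z + e G1 z) equal to Re (F1 z) - |G1 z|. *)
  destruct (Cmod_rotate (- G1 z)%C) as [e [He Hrot]]. rewrite Cmod_opp in Hrot.
  destruct (power_sum_uniform F cF 1 (Cmod u) (delta / 8) HF (conj (Cmod_ge_0 u) Hu) ltac:(lra)) as [N1 K1].
  destruct (power_sum_uniform G cG 1 (Cmod u) (delta / 8) HG (conj (Cmod_ge_0 u) Hu) ltac:(lra)) as [N2 K2].
  destruct (is_series_C_partial _ _ (HF1 z Hz) (delta / 8) ltac:(lra)) as [N3 K3].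
  destruct (is_series_C_partial _ _ (HG1 z Hz) (delta / 8) ltac:(lra)) as [N4 K4].
  set (n := (N1 + N2 + N3 + N4)%nat).
  specialize (K3 n ltac:(lia)). specialize (K4 n ltac:(lia)).
  set (q := fun k => ((cF k + e * cG k) * u ^ k)%C).
  (* Truncating F and G costs delta/8 each, leaving more than delta/2; truncating F1 and G1 costs
     another delta/4 in total, so the result stays positive. *)
  assert (Have : delta / 2 <= Re (Csum (fun k => q k * (taylor_coeff phi (S k) * RtoC rho ^ k))%C n)).
  { apply kernel_average_bound; auto; [lra | ]. intros t Ht.
    specialize (Hmargin t Ht). set (w := (u * Cconj (circle t))%C) in *.
    assert (Hw : Cmod w <= Cmod u).
    { unfold w. rewrite Cmod_mult, Cmod_conj, Cmod_circle. lra. }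
    specialize (K1 n w ltac:(lia) Hw). specialize (K2 n w ltac:(lia) Hw).
    rewrite (Csum_ext _ (fun k => cF k * w ^ k + e * (cG k * w ^ k))%C)
      by (intros; unfold q, w; rewrite Cpow_mult_l; ring).
    rewrite Csum_plus, Csum_scal.
    set (SF := Csum (fun k => cF k * w ^ k)%C n) in *.
    set (SG := Csum (fun k => cG k * w ^ k)%C n) in *.
    assert (B1 := re_le_Cmod (F w - SF)%C). rewrite Re_minus in B1.
    assert (B2 := re_le_Cmod (e * SG)%C). rewrite Cmod_mult, He in B2.
    assert (B3 : Cmod SG <= Cmod (G w) + Cmod (G w - SG)%C).
    { replace SG with (G w + - (G w - SG))%C at 1 by ring.
      rewrite <- (Cmod_opp (G w - SG)%C). apply Cmod_triangle. }
    apply Rabs_le_between in B2.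
    assert (B1' := Rle_trans _ _ _ B1 K1). apply Rabs_le_between in B1'.
    rewrite re_plus. lra. }
  rewrite (Csum_ext _ (fun k => cF k * taylor_coeff phi (S k) * z ^ k
                             + e * (cG k * taylor_coeff phi (S k) * z ^ k))%C) in Have
    by (intros; unfold q; rewrite Hzu, Cpow_mult_l; ring).
  rewrite Csum_plus, Csum_scal, re_plus in Have.
  set (SF := Csum (fun k => cF k * taylor_coeff phi (S k) * z ^ k)%C n) in *.
  set (SG := Csum (fun k => cG k * taylor_coeff phi (S k) * z ^ k)%C n) in *.
  assert (B1 := re_le_Cmod (SF - F1 z)%C). rewrite Re_minus in B1.
  assert (B2 := re_le_Cmod (e * (SG - G1 z))%C). rewrite Cmod_mult, He in B2.
  replace (e * (SG - G1 z))%C with (e * SG + e * - G1 z)%C in B2 by ring.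
  rewrite Hrot, re_plus in B2. change (Re (RtoC (Cmod (G1 z)))) with (Cmod (G1 z)) in B2.
  assert (B1' := Rle_trans _ _ _ B1 (Rlt_le _ _ K3)). apply Rabs_le_between in B1'.
  assert (B2' : Rabs (Re (e * SG)%C + Cmod (G1 z)) <= delta / 8) by lra.
  apply Rabs_le_between in B2'. lra.
Qed.

(** * The operator and the convolution on Taylor coefficients *)

(** The operator lowers degrees by one, so its coefficient at n comes from index n + 1. This is the
    same shift as in phi(z)/z, and it makes the two operations compatible. *)
Definition diff_op_coeff (alpha : R) (c : nat -> C) (n : nat) : C :=
  (RtoC ((1 - alpha) * INR (S n) + alpha * (INR n * INR (S n))) * c (S n))%C.

Lemma diff_op_power_sum (alpha : R) (k : C -> C) (c : nat -> C) (R0 : R) :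
  power_sum k c R0 -> power_sum (diff_op alpha k) (diff_op_coeff alpha c) R0.
Proof.
  intros Hk z Hz. assert (H1 := power_sum_derive k c R0 Hk).
  assert (H2 := power_sum_derive _ _ R0 H1 z Hz). specialize (H1 z Hz).
  apply (is_series_C_scal z) in H2.
  (* The factor [INR n] vanishes at n = 0, which accounts for multiplication by z. *)
  assert (H3 : Cis_series (fun n => RtoC (INR n * INR (S n)) * c (S n) * z ^ n)%C
                 (z * C_derive (C_derive k) z)%C).
  { apply is_series_C_shift.
    replace (z * C_derive (C_derive k) z - RtoC (INR 0 * INR 1) * c 1%nat * z ^ 0)%C
      with (z * C_derive (C_derive k) z)%C by (simpl INR; rewrite Rmult_0_l; ring).
    apply is_series_C_ext with (2 := H2). intros n. unfold derived.
    rewrite RtoC_mult, Cpow_S. ring. }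
  apply (is_series_C_scal (RtoC alpha)) in H3.
  apply (is_series_C_scal (RtoC (1 - alpha))) in H1.
  assert (HS := is_series_C_plus _ _ _ _ H1 H3).
  replace (RtoC alpha * (z * C_derive (C_derive k) z))%C
    with (RtoC alpha * z * C_derive (C_derive k) z)%C in HS by ring.
  apply is_series_C_ext with (2 := HS). intros n. unfold derived, diff_op_coeff.
  rewrite RtoC_plus, !RtoC_mult. ring.
Qed.

Lemma power_sum_add_const (f : C -> C) (c : nat -> C) (R0 : R) (a : C) :
  power_sum f c R0 ->
  power_sum (fun z => f z + a)%C
    (fun n => match n with O => c 0%nat + a | S _ => c n end)%C R0.
Proof.
  intros Hf z Hz. specialize (Hf z Hz). apply is_series_C_shift in Hf.
  apply is_series_C_shift.
  replace (f z + a - (c 0%nat + a) * z ^ 0)%C with (f z - c 0%nat * z ^ 0)%C by (simpl; ring).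
  exact Hf.
Qed.

(** [CSeries] is a total function, so convergence has to be proved. With |phi_n| rho^n <= 1 the
    terms at radius r are dominated by those of f at radius r/rho < 1. *)
Lemma hadamard_power_sum (phi f : C -> C) (c : nat -> C) :
  class_A phi -> (forall z, unit_disc z -> Re (div_by_id phi z) > 1 / 2) ->
  power_sum f c 1 ->
  power_sum (hadamard f phi) (fun n => c n * taylor_coeff phi n)%C 1.
Proof.
  intros HA Hphi Hf.
  apply power_sum_ext with (fun z => CSeries (fun n => c n * taylor_coeff phi n * z ^ n)%C).
  { intros z _. unfold hadamard, CSeries.
    f_equal; apply Series_ext; intros n; now rewrite (power_sum_taylor f c 1 n Rlt_0_1 Hf). }
  apply abs_summable_power_sum. intros r Hr.
  set (rho := (1 + r) / 2). assert (Hrho : r < rho < 1) by (unfold rho; lra).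
  assert (Hq : 0 <= r / rho < 1) by (split; [apply Rle_div_r | apply Rlt_div_l]; lra).
  apply (ex_series_le (K := R_AbsRing) (V := R_CompleteNormedModule))
    with (2 := power_sum_abs_summable f c 1 (r / rho) Hf Hq).
  intros n. unfold norm; simpl; unfold abs; simpl.
  rewrite Rabs_pos_eq by (apply Rmult_le_pos; [apply Cmod_ge_0 | apply pow_le; lra]).
  rewrite Cmod_mult, Rmult_assoc. apply Rmult_le_compat_l; [apply Cmod_ge_0 | ].
  assert (Hp : 0 <= (r / rho) ^ n) by (apply pow_le; lra).
  replace (r ^ n) with ((r / rho) ^ n * rho ^ n).
  2:{ rewrite <- Rpow_mult_distr. f_equal. field. lra. }
  enough (Cmod (taylor_coeff phi n) * rho ^ n <= 1) as Hb.
  { replace (Cmod (taylor_coeff phi n) * ((r / rho) ^ n * rho ^ n))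
      with ((r / rho) ^ n * (Cmod (taylor_coeff phi n) * rho ^ n)) by ring.
    rewrite <- (Rmult_1_r ((r / rho) ^ n)) at 2. now apply Rmult_le_compat_l. }
  (* The coefficient bound starts at index 1; index 0 is covered by phi(0) = 0. *)
  destruct n as [|n].
  - rewrite taylor_coeff_0, (proj1 (proj2 HA)), Cmod_0. lra.
  - assert (Hb := taylor_coeff_bound phi rho n HA Hphi ltac:(lra)).
    replace (Cmod (taylor_coeff phi (S n)) * rho ^ S n)
      with (rho * (Cmod (taylor_coeff phi (S n)) * rho ^ n)) by (simpl; ring).
    apply Rle_trans with (rho * 1); [apply Rmult_le_compat_l; lra | lra].
Qed.

(** * Comparison of two decompositions of a harmonic map *)

Lemma Cconj_RtoC (x : R) : Cconj (RtoC x) = RtoC x.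
Proof. unfold Cconj, RtoC; simpl. now rewrite Ropp_0. Qed.

(* Comparing increments along 1 and i separates the C-linear part from the
   antilinear one. *)
Lemma holomorphic_antiholomorphic_derive (U V : C -> C) (z L M : C) (r : R) :
  0 < r -> C_first_order U z L -> C_first_order V z M ->
  (forall w, Cmod w < r -> (U (z + w) + Cconj (V (z + w)))%C = RtoC 0) ->
  L = RtoC 0 /\ M = RtoC 0.
Proof.
  intros Hr HU HV H.
  assert (Hz : (U z + Cconj (V z))%C = RtoC 0).
  { replace z with (z + RtoC 0)%C by ring. apply H. now rewrite Cmod_0. }
  assert (Hlin : forall e, 0 < e -> exists d, 0 < d /\ forall w, Cmod w < d ->
            Cmod (L * w + Cconj (M * w))%C <= e * Cmod w).
  { intros e He.
    destruct (HU (e / 2) ltac:(lra)) as [d1 [Hd1 A]], (HV (e / 2) ltac:(lra)) as [d2 [Hd2 B]].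
    exists (Rmin r (Rmin d1 d2)). split; [repeat apply Rmin_glb_lt; auto | ].
    intros w Hw.
    assert (Hw1 := Rlt_le_trans _ _ _ Hw (Rmin_l _ _)).
    assert (Hw2 := Rlt_le_trans _ _ _ Hw (Rmin_r _ _)).
    specialize (A w (Rlt_le_trans _ _ _ Hw2 (Rmin_l _ _))).
    specialize (B w (Rlt_le_trans _ _ _ Hw2 (Rmin_r _ _))).
    specialize (H w Hw1).
    rewrite <- Cmod_conj, !Cminus_conj in B.
    (* The linear part is minus the two first-order remainders plus an increment of U + conj V, and
       that increment is zero. *)
    replace (L * w + Cconj (M * w))%C with
      (- ((U (z + w) - U z - L * w)
          + (Cconj (V (z + w)) - Cconj (V z) - Cconj (M * w)))
       + ((U (z + w) + Cconj (V (z + w))) - (U z + Cconj (V z))))%C by ring.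
    rewrite H, Hz. replace (0 - 0)%C with (RtoC 0) by ring. rewrite Cplus_0_r, Cmod_opp.
    apply Rle_trans with (1 := Cmod_triangle _ _). lra. }
  assert (Hsmall : forall e, 0 < e -> Cmod (L + Cconj M)%C <= e /\ Cmod (L - Cconj M)%C <= e).
  { intros e He. destruct (Hlin e He) as [d [Hd A]].
    set (s := RtoC (d / 2)). assert (Hs : Cmod s = d / 2) by (apply Cmod_RtoC_pos; lra).
    assert (A1 := A s ltac:(lra)).
    assert (A2 := A (Ci * s)%C ltac:(rewrite Cmod_mult, Cmod_Ci; lra)).
    replace (L * s + Cconj (M * s))%C with ((L + Cconj M) * s)%C in A1.
    2:{ rewrite Cmult_conj. unfold s. rewrite Cconj_RtoC. ring. }
    replace (L * (Ci * s) + Cconj (M * (Ci * s)))%C with ((L - Cconj M) * (Ci * s))%C in A2.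
    2:{ rewrite !Cmult_conj. unfold s. rewrite Cconj_RtoC.
        replace (Cconj Ci) with (- Ci)%C by (unfold Cconj, Copp, Ci; simpl; f_equal; ring). ring. }
    rewrite Cmod_mult in A1. rewrite !Cmod_mult, Cmod_Ci, Rmult_1_l in A2.
    split; apply Rmult_le_reg_r with (Cmod s); lra. }
  assert (Hzero : forall x : C, (forall e, 0 < e -> Cmod x <= e) -> x = RtoC 0).
  { intros x Hx. apply Cmod_eq_0, Rle_antisym; [ | apply Cmod_ge_0].
    apply Rle_of_eps with 1; [lra | ]. intros e He. rewrite Rplus_0_l, Rmult_1_r. auto. }
  assert (E1 := Hzero _ (fun e He => proj1 (Hsmall e He))).
  assert (E2 := Hzero _ (fun e He => proj2 (Hsmall e He))).
  assert (E3 : (RtoC 2 * L)%C = RtoC 0).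
  { replace (RtoC 2 * L)%C with ((L + Cconj M) + (L - Cconj M))%C by ring. rewrite E1, E2. ring. }
  assert (HL : L = RtoC 0).
  { replace L with (/ RtoC 2 * (RtoC 2 * L))%C by (field; intros E; injection E; lra).
    rewrite E3. ring. }
  split; [exact HL | ].
  rewrite <- (Cconj_conj M). replace (Cconj M) with (L + Cconj M)%C by (rewrite HL; ring).
  rewrite E1, Cconj_RtoC. reflexivity.
Qed.

(** Transfers the inequality from the decomposition provided by [class_P0] to the one used in the
    convolution. *)
Lemma harmonic_parts_derive (f h g h1 g1 : C -> C) (z : C) :
  class_H_repr f h g -> class_H_repr f h1 g1 -> unit_disc z ->
  C_derive h z = C_derive h1 z /\ C_derive g z = C_derive g1 z.
Proof.
  intros [Ah [Ag [_ [_ [_ Hf]]]]] [Ah1 [Ag1 [_ [_ [_ Hf1]]]]] Hz.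
  destruct (holomorphic_antiholomorphic_derive
    (fun w => h w + RtoC (-1) * h1 w)%C (fun w => g w + RtoC (-1) * g1 w)%C z
    (C_derive h z + (0 * h1 z + RtoC (-1) * C_derive h1 z))%C
    (C_derive g z + (0 * g1 z + RtoC (-1) * C_derive g1 z))%C (1 - Cmod z)) as [E1 E2].
  - unfold unit_disc in Hz. lra.
  - apply first_order_plus; [now apply analytic_at_first_order, Ah | ].
    apply first_order_mult; [apply first_order_const | now apply analytic_at_first_order, Ah1].
  - apply first_order_plus; [now apply analytic_at_first_order, Ag | ].
    apply first_order_mult; [apply first_order_const | now apply analytic_at_first_order, Ag1].
  - intros w Hw. assert (Hzw : unit_disc (z + w)%C).
    { apply Rle_lt_trans with (1 := Cmod_triangle _ _). lra. }
    assert (E := Hf _ Hzw). rewrite (Hf1 _ Hzw) in E.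
    rewrite Cplus_conj, Cmult_conj, Cconj_RtoC.
    replace (h (z + w) + RtoC (-1) * h1 (z + w) + (Cconj (g (z + w)) + RtoC (-1) * Cconj (g1 (z + w))))%C
      with ((h (z + w) + Cconj (g (z + w))) - (h1 (z + w) + Cconj (g1 (z + w))))%C by ring.
    rewrite E. ring.
  - split.
    + replace (C_derive h z) with ((C_derive h z + (0 * h1 z + RtoC (-1) * C_derive h1 z)) + C_derive h1 z)%C by ring.
      rewrite E1. ring.
    + replace (C_derive g z) with ((C_derive g z + (0 * g1 z + RtoC (-1) * C_derive g1 z)) + C_derive g1 z)%C by ring.
      rewrite E2. ring.
Qed.

(** The second derivative at z depends on the first one near z, so the equality is carried over on a
    ball of radius 1 - |z|. *)
Lemma diff_op_eq (alpha : R) (k k1 : C -> C) (z : C) :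
  analytic_in_disc k -> unit_disc z ->
  (forall w, unit_disc w -> C_derive k w = C_derive k1 w) ->
  diff_op alpha k z = diff_op alpha k1 z.
Proof.
  intros Hk Hz H. unfold diff_op. rewrite (H z Hz). do 2 f_equal.
  symmetry. apply first_order_C_derive.
  apply first_order_ext_ball with (C_derive k) (1 - Cmod z).
  - unfold unit_disc in Hz. lra.
  - intros w Hw. apply H. apply Rle_lt_trans with (1 := Cmod_triangle _ _). lra.
  - now apply analytic_at_first_order, analytic_at_derive, Hk.
Qed.

(** The given series fixes its coefficients from degree 2 on and says nothing of [a 0] and [a 1], so
    the two lowest coefficients are rebuilt by cases. *)
Lemma power_sum_of_tail (f : C -> C) (a : nat -> C) (a1 : C) :
  (forall z, unit_disc z -> Cis_series (fun k => a (k + 2)%nat * z ^ (k + 2))%C (f z - a1 * z)%C) ->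
  power_sum f (fun n => match n with O => RtoC 0 | S O => a1 | S (S k) => a (k + 2)%nat end) 1.
Proof.
  intros H z Hz. apply is_series_C_shift, is_series_C_shift.
  replace (f z - 0 * z ^ 0 - a1 * z ^ 1)%C with (f z - a1 * z)%C by (simpl; ring).
  apply is_series_C_ext with (2 := H z Hz). intros k.
  now replace (k + 2)%nat with (S (S k)) by lia.
Qed.

Theorem theorem3p3 :
  forall (M alpha : R) (f h g phi : C -> C) (a b : nat -> C),
    0 < M -> 0 < alpha <= 1 ->
    class_P0 alpha M f ->
    class_H_repr f h g ->
    (forall z : C, unit_disc z ->
       @is_series C_AbsRing C_NormedModule
         (fun k : nat => (a (k + 2)%nat * z ^ (k + 2))%C) (h z - z)%C) ->
    (forall z : C, unit_disc z ->
       @is_series C_AbsRing C_NormedModule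
         (fun k : nat => (b (k + 2)%nat * z ^ (k + 2))%C) (g z)) ->
    class_A phi ->
    (forall z : C, unit_disc z -> Re (div_by_id phi z) > 1 / 2) ->
    class_P0 alpha M (harmonic_conv h g phi).
Proof.
  intros M alpha f h g phi a b _ _ [h1 [g1 [Hr1 [_ Hineq]]]] Hr Ha Hb HA Hphi.
  assert (Hh : power_sum h (fun n => match n with O => RtoC 0 | S O => RtoC 1 | S (S k) => a (k + 2)%nat end) 1).
  { apply power_sum_of_tail. intros z Hz. replace (1 * z)%C with z by ring. auto. }
  assert (Hg : power_sum g (fun n => match n with O => RtoC 0 | S O => RtoC 0 | S (S k) => b (k + 2)%nat end) 1).
  { apply power_sum_of_tail. intros z Hz. replace (g z - 0 * z)%C with (g z) by ring. auto. }
  set (ch := fun n => _) in Hh. set (cg := fun n => _) in Hg.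
  assert (Hhp := hadamard_power_sum phi h ch HA Hphi Hh).
  assert (Hgp := hadamard_power_sum phi g cg HA Hphi Hg).
  assert (Hphi1 : taylor_coeff phi 1 = RtoC 1) by (rewrite taylor_coeff_1; apply HA).
  exists (hadamard h phi), (hadamard g phi). split; [ | split].
  - repeat split.
    + apply power_sum_analytic with (1 := Hhp).
    + apply power_sum_analytic with (1 := Hgp).
    + rewrite (power_sum_at_0 _ _ 1 Rlt_0_1 Hhp). simpl. ring.
    + rewrite (power_sum_derive_0 _ _ 1 Rlt_0_1 Hhp), Hphi1. simpl. ring.
    + rewrite (power_sum_at_0 _ _ 1 Rlt_0_1 Hgp). simpl. ring.
  - rewrite (power_sum_derive_0 _ _ 1 Rlt_0_1 Hgp). simpl. ring.
  - intros z Hz.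
    enough (Hd : Cmod (diff_op alpha (hadamard g phi) z)
                 < Re (diff_op alpha (hadamard h phi) z + RtoC M)%C).
    { rewrite re_plus in Hd. simpl (Re (RtoC M)) in Hd. lra. }
    apply (convolution_dominates phi
      (fun z => diff_op alpha h z + RtoC M)%C (diff_op alpha g)
      (fun z => diff_op alpha (hadamard h phi) z + RtoC M)%C (diff_op alpha (hadamard g phi))
      (fun n => match n with O => diff_op_coeff alpha ch 0 + RtoC M | S _ => diff_op_coeff alpha ch n end)%C
      (diff_op_coeff alpha cg)); auto.
    + now apply power_sum_add_const, diff_op_power_sum.
    + now apply diff_op_power_sum.
    + intros w Hw.
      refine (is_series_C_ext _ _ _ _
        (power_sum_add_const _ _ 1 (RtoC M) (diff_op_power_sum alpha _ _ 1 Hhp) w Hw)).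
      (* Only the constant coefficient contains M, and it is multiplied by phi'(0) = 1: the shift by
         M commutes with the convolution. *)
      intros [|n]; unfold diff_op_coeff; [rewrite Hphi1 | ]; ring.
    + intros w Hw.
      refine (is_series_C_ext _ _ _ _ (diff_op_power_sum alpha _ _ 1 Hgp w Hw)).
      intros n. unfold diff_op_coeff. ring.
    + intros w Hw. specialize (Hineq w Hw).
      (* The hypothesis speaks of [h1] and [g1], so the operator is first rewritten in their
         terms. *)
      rewrite (diff_op_eq alpha h h1 w (proj1 Hr) Hw), (diff_op_eq alpha g g1 w (proj1 (proj2 Hr)) Hw).
      * rewrite re_plus. simpl (Re (RtoC M)). lra.
      * intros v Hv. now apply (harmonic_parts_derive f h g h1 g1).
      * intros v Hv. now apply (harmonic_parts_derive f h g h1 g1).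
Qed.
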